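(* Let $j\in\{0,\ldots,J-1\}$ and let $\bar Y$ be a supersolution to the dynamic program $$Y_i=F_i(E_i[\beta_{i+1}Y_{i+1}]),\quad i=J-1,\ldots,0,\qquad Y_J=\xi,$$ whose solution is denoted by $Y$. Further, let $\bar M$ be the Doob martingale of the process $\beta\bar Y$. Then the process $\theta^{up}(\bar M)$ satisfies $$Y_i\ \le\ E_i\left[\theta_i^{up}(\bar M)\right]\ \le\ F_i\left(E_i[\beta_{i+1}\bar Y_{i+1}]\right)\ \le\ \bar Y_i\quad P\text{-a.s.}$$ for all $i=0,\ldots,J-1$. Moreover, if $\bar Y_i=Y_i$ for all $i=j+1,\ldots,J$, then $$\theta_j^{up}(\bar M)=Y_j\quad P\text{-a.s.}$$
   Context: Setting. $(\Omega,\mathcal F,(\mathcal F_j)_{j=0,\ldots,J},P)$ is a complete filtered probability space in discrete time, and $E_j[\cdot]$ denotes conditional expectation given $\mathcal F_j$. For $m\in\mathbb N$, $L^{\infty-}(\mathbb R^m)$ is the set of $\mathbb R^m$-valued ($\mathcal F$-measurable) random variables that are in $L^p(\Omega,P)$ for all $p\ge1$; $L^{\infty-}_j(\mathbb R^m)$ is the subset of $\mathcal F_j$-measurable ones; $L^{\infty-}_{ad}(\mathbb R^m)$ is the set of adapted processes $Z$ with $Z_j\in L_j^{\infty-}(\mathbb R^m)$ for every $j=0,\ldots,J$. Standing assumptions on the data. (i) For $j=0,\ldots,J-1$, $F_j:\Omega\times\mathbb R^D\to\mathbb R$ is measurable, $F_j(\cdot,z)$ is $\mathcal F_j$-measurable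 for every $z\in\mathbb R^D$, and $z\mapsto F_j(\omega,z)$ is convex for every $\omega\in\Omega$. (ii) There are a constant $q\ge0$ and a nonnegative adapted process $\alpha$ with $\alpha_j\in L^p(\Omega,P)$ for all $p\ge1$ such that $|F_j(z)|\le\alpha_j(1+|z|^q)$ $P$-a.s. for every $z\in\mathbb R^D$ and $j=0,\ldots,J-1$. (iii) $\beta$ is an adapted $\mathbb R^D$-valued process in $L^p(\Omega,P)$ for all $p\ge1$, and $\xi$ is a real-valued $\mathcal F_J$-measurable random variable with $E[|\xi|^p]<\infty$ for all $p\ge1$. (iv) Monotonicity: for all $Y^{(1)},Y^{(2)}\in L^{\infty-}(\mathbb R)$ with $Y^{(1)}\ge Y^{(2)}$ $P$-a.s. and every $j=0,\ldots,J-1$, $F_j(\beta_{j+1}Y^{(1)})\ge F_j(\beta_{j+1}Y^{(2)})$ $P$-a.s. Under (i)–(iii) the dynamic program has a $P$-a.s. unique solution $Y\in L^{\infty-}_{ad}(\mathbb R)$. Definitions. A process $\bar Y\in L^{\infty-}_{ad}(\mathbb R)$ is a supersolution to the dynamic program if $\bar Y_J\ge Y_J$ and $\bar Y_j\ge F_j(E_j[\beta_{j+1}\bar Y_{j+1}])$ $P$-a.s. for every $j=0,\ldots,J-1$. $\mathcal M_D$ is the set of $\mathbb R^D$-valued martingales that are elements of $L^{\infty-}_{ad}(\mathbb R^D)$. The Doob martingale of a process $Z\in L^{\infty-}_{ad}(\mathbb R^D)$ is the process $\sum_{i=0}^{j-1}(Z_{i+1}-E_i[Z_{i+1}])$, $j=0,\ldots,J$;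 in particular the Doob martingale of $\beta\bar Y$ is $\sum_{i=0}^{j-1}(\beta_{i+1}\bar Y_{i+1}-E_i[\beta_{i+1}\bar Y_{i+1}])$, which belongs to $\mathcal M_D$. For $M\in\mathcal M_D$, the (typically non-adapted) process $\theta^{up}=\theta^{up}(M)$ is defined by the pathwise backward recursion $$\theta_J^{up}=\xi,\qquad \theta_j^{up}=F_j\left(\beta_{j+1}\theta_{j+1}^{up}-(M_{j+1}-M_j)\right),\quad j=J-1,\ldots,0.$$ *)

(* Defs.v *)
From HB Require Import structures.
From mathcomp Require Import all_boot all_order all_algebra.
From mathcomp Require Import all_classical all_reals all_analysis.

Set Implicit Arguments.
Unset Strict Implicit.
Unset Printing Implicit Defensive.
Import Order.TTheory GRing.Theory Num.Theory.
Import numFieldNormedType.Exports.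

Local Open Scope classical_set_scope.
Local Open Scope ring_scope.

(* The default norm on 'rV[R]_m is the sup norm, hence this definition. *)
Definition enorm (R : realType) (m : nat) (z : 'rV[R]_m) : R :=
  Num.sqrt (\sum_(i < m) z ord0 i ^+ 2).

Section stochastic_basis.
Context (R : realType) (d : measure_display) (T : measurableType d).
Variable P : probability T R.

(* For a sigma-algebra G, [g_sigma_algebraType G] is T equipped with G. *)
Definition measurable_wrt (G : set (set T)) (X : T -> R) : Prop :=
  measurable_fun [set: g_sigma_algebraType G] (X : g_sigma_algebraType G -> R).

Definition measurable_wrt_rV (m : nat) (G : set (set T)) (X : T -> 'rV[R]_m) :
    Prop :=
  forall i, measurable_wrt G (fun w => X w ord0 i).

(* Time runs through 0, ..., J; values at later indices are irrelevant here and
   for all processes below. *)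
Definition complete_filtration (J : nat) (FF : nat -> set (set T)) : Prop :=
  [/\ measure_is_complete P,
      P.-negligible `<=` FF 0%N,
      forall j, (j <= J)%N -> sigma_algebra setT (FF j),
      forall j, (j <= J)%N -> FF j `<=` measurable
    & forall i j, (i <= j)%N -> (j <= J)%N -> FF i `<=` FF j].

Definition Linfm (X : T -> R) : Prop :=
  forall p : R, 1 <= p -> X \in Lfun P p%:E.

Definition Linfm_rV (m : nat) (X : T -> 'rV[R]_m) : Prop :=
  measurable_wrt_rV measurable X /\ Linfm (fun w => enorm (X w)).

Definition Linfm_ad (J : nat) (FF : nat -> set (set T)) (Z : nat -> T -> R) :
    Prop :=
  forall j, (j <= J)%N -> measurable_wrt (FF j) (Z j) /\ Linfm (Z j).

Definition Linfm_rV_ad (m J : nat) (FF : nat -> set (set T))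
    (Z : nat -> T -> 'rV[R]_m) : Prop :=
  forall j, (j <= J)%N -> measurable_wrt_rV (FF j) (Z j) /\ Linfm_rV (Z j).

Definition is_condexp (G : set (set T)) (X Z : T -> R) : Prop :=
  [/\ measurable_wrt G Z,
      P.-integrable setT (EFin \o Z)
    & forall A, G A ->
        (\int[P]_(w in A) (Z w)%:E = \int[P]_(w in A) (X w)%:E)%E].

(* An arbitrary version of the conditional expectation, with junk value 0 when
   there is none; one exists whenever X is integrable and G is a
   sub-sigma-algebra. *)
Definition condexp (G : set (set T)) (X : T -> R) : T -> R :=
  xget (fun=> 0) [set Z | is_condexp G X Z].

Definition condexp_rV (m : nat) (G : set (set T)) (X : T -> 'rV[R]_m) (w : T) :
    'rV[R]_m :=
  \row_i condexp G (fun w' => X w' ord0 i) w.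

Section dynamic_program.
Variables (J D : nat) (FF : nat -> set (set T)).
Variable F : nat -> T -> 'rV[R]_D -> R.
Variables (beta : nat -> T -> 'rV[R]_D) (xi : T -> R).

(* R^D carries the product sigma-algebra of the library on [D.-tuple R]. *)
Definition convex_generator : Prop :=
  forall j, (j < J)%N ->
  [/\ measurable_fun [set: T * D.-tuple R]
        (fun p : T * D.-tuple R => F j p.1 (\row_i tnth p.2 i)),
      forall z, measurable_wrt (FF j) (fun w => F j w z)
    & forall w, convex_function [set: convex_lmodType 'rV[R]_D] (F j w)].

Definition polynomial_growth : Prop :=
  exists (q : R) (alpha : nat -> T -> R),
  [/\ 0 <= q,
      forall j w, (j <= J)%N -> 0 <= alpha j w,
      Linfm_ad J FF alpha
    & forall j (z : 'rV[R]_D), (j < J)%N ->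
        {ae P, forall w, `|F j w z| <= alpha j w * (1 + enorm z `^ q)}].

Definition monotone_generator : Prop :=
  forall Y1 Y2 : T -> R, Linfm Y1 -> Linfm Y2 ->
  {ae P, forall w, Y2 w <= Y1 w} ->
  forall j, (j < J)%N ->
  {ae P, forall w,
    F j w (Y2 w *: beta j.+1 w) <= F j w (Y1 w *: beta j.+1 w)}.

Definition standing_assumptions : Prop :=
  [/\ complete_filtration J FF,
      convex_generator,
      polynomial_growth,
      Linfm_rV_ad J FF beta /\ (measurable_wrt (FF J) xi /\ Linfm xi)
    & monotone_generator].

Definition weighted (Y : nat -> T -> R) (i : nat) (w : T) : 'rV[R]_D :=
  Y i w *: beta i w.

Definition dp_rhs (Y : nat -> T -> R) (j : nat) (w : T) : R :=
  F j w (condexp_rV (FF j) (weighted Y j.+1) w).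

Definition dp_solution (Y : nat -> T -> R) : Prop :=
  [/\ Linfm_ad J FF Y,
      {ae P, forall w, Y J w = xi w}
    & forall j, (j < J)%N -> {ae P, forall w, Y j w = dp_rhs Y j w}].

Definition supersolution (Y Ybar : nat -> T -> R) : Prop :=
  [/\ Linfm_ad J FF Ybar,
      {ae P, forall w, Y J w <= Ybar J w}
    & forall j, (j < J)%N -> {ae P, forall w, dp_rhs Ybar j w <= Ybar j w}].

Definition doob_martingale (Z : nat -> T -> 'rV[R]_D) (j : nat) (w : T) :
    'rV[R]_D :=
  \sum_(0 <= i < j) (Z i.+1 w - condexp_rV (FF i) (Z i.+1) w).

(* The recursion runs on the time n = J - j to maturity; lemmas [theta_upJ] and
   [theta_upS] give its usual form. *)
Fixpoint theta_rev (M : nat -> T -> 'rV[R]_D) (n : nat) (w : T) : R :=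
  if n is n'.+1 then
    let j := (J - n'.+1)%N in
    F j w (theta_rev M n' w *: beta j.+1 w - (M j.+1 w - M j w))
  else xi w.

Definition theta_up (M : nat -> T -> 'rV[R]_D) (j : nat) (w : T) : R :=
  theta_rev M (J - j) w.

Lemma theta_upJ M w : theta_up M J w = xi w.
Proof. by rewrite /theta_up subnn. Qed.

Lemma theta_upS M j w : (j < J)%N ->
  theta_up M j w =
  F j w (theta_up M j.+1 w *: beta j.+1 w - (M j.+1 w - M j w)).
Proof.
by move=> jJ; rewrite /theta_up -(subnSK jJ)/= subnSK// (subKn (ltnW jJ)).
Qed.

End dynamic_program.
End stochastic_basis.

(* Main.v *)
Require Import Defs.
From HB Require Import structures.
From mathcomp Require Import all_boot all_order all_algebra.
From mathcomp Require Import all_classical all_reals all_analysis.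
From mathcomp Require Import ring lra measurable_realfun.

Set Implicit Arguments.
Unset Strict Implicit.
Unset Printing Implicit Defensive.
Import Order.TTheory GRing.Theory Num.Theory.
Import numFieldNormedType.Exports.

Local Open Scope classical_set_scope.
Local Open Scope ring_scope.

(** The theorem rests on two consequences of convexity and monotonicity.

    First, monotonicity makes [- beta_{i+1}] a direction in which [F_i]
    is nonincreasing from every point. Comparing the constants [-n] and [0] gives
    [F_i (- n beta_{i+1}) <= F_i 0] almost surely for all [n], and a finite
    convex function bounded above along a ray from the origin cannot increase
    along any parallel ray ([recession_direction], [beta_recession]).
    This pathwise inequality replaces the hypothesis, which compares random
    variables, in everything that follows.

    Secondly, the conditional Jensen inequality [F_i (E_i[X]) <= E_i[F_i (X)]]
    holds for the random convex function [F_i], which is known at time [i]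
    ([conditional_jensen]). The function [F_i + eps |.|^2] is the supremum of its
    affine minorants with rational coefficients
    ([rational_affine_minorant]). For each of these countably many affine
    functions, the event that it is a minorant belongs to the sigma-algebra at
    time [i], so the linear inequality may be conditioned on that event; then
    [eps] tends to [0]. The quadratic term is what makes rational slopes enough:
    a linear function with an irrational slope has no rational affine minorant.
    The same supremum shows that [F_i (z)] is measurable at time [i] when [z] is.

    Upper bound: with [C_i = E_i[beta_{i+1} Ybar_{i+1}]], the increments of the
    Doob martingale turn the recursion into
    [theta_i = F_i (C_i - (Ybar_{i+1} - theta_{i+1}) beta_{i+1})].
    If [theta_{i+1} <= Ybar_{i+1}], the recession property gives
    [theta_i <= F_i (C_i) <= Ybar_i]; this is a pathwise backward induction, and
    taking [E_i] yields the middle inequality. If moreover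
    [Ybar_{i+1} = Y_{i+1} = theta_{i+1}], the correction term vanishes, whence
    the last assertion.

    Lower bound: if [Y_{i+1} <= E_{i+1}[theta_{i+1}]], Jensen's inequality gives
    [E_i[theta_i] >= F_i (E_i[beta_{i+1} theta_{i+1}])
                   = F_i (E_i[beta_{i+1} E_{i+1}[theta_{i+1}]])]
    by the tower property and by taking out [beta_{i+1}], and the right-hand side
    is at least [F_i (E_i[beta_{i+1} Y_{i+1}]) = Y_i] because
    [U |-> F_i (E_i[beta_{i+1} U])] is monotone ([generator_condexp_mono]). *)

(** * Convex functions on a finite-dimensional space *)

Section convex_functions.
Context {R : realType}.

(** The weight is a plain real number, so that linear arithmetic applies to
    instances. *)
Definition convexf (V : lmodType R) (f : V -> R) : Prop :=
  forall (t : R) (x y : V), 0 <= t <= 1 ->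
    f (t *: x + (1 - t) *: y) <= t * f x + (1 - t) * f y.

Lemma convex_functionT (V : lmodType R) (f : V -> R) :
  convex_function [set: convex_lmodType V] f -> convexf f.
Proof.
move=> cf t x y /andP[t0 t1].
exact: (cf (Itv01 t0 t1) x y (mem_set I) (mem_set I)).
Qed.

Lemma convexfD (V : lmodType R) (f g : V -> R) :
  convexf f -> convexf g -> convexf (fun x => f x + g x).
Proof. by move=> cf cg t x y t01; have := cf t x y t01; have := cg t x y t01; lra. Qed.

(** Convexity bounds [g] above on [[x, x + 1]] by its chord, which is continuous
    at [x]: points slightly to the right of [x] still lie below [c]. *)
Lemma convexf_below_rat (g : R^o -> R) (x c : R) : convexf g -> g x < c ->
  exists2 a : rat, `|ratr a - x| <= 1 & g (ratr a) < c.
Proof.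
move=> cg gx; pose M := g (x + 1); pose d := (c - g x) / (`|M - g x| + (c - g x)).
have c0 : 0 < c - g x by rewrite subr_gt0.
have e0 : 0 < `|M - g x| + (c - g x) by rewrite ltr_wpDl.
have d0 : 0 < d by rewrite divr_gt0.
have d1 : d <= 1 by rewrite ler_pdivrMr// mul1r lerDr.
have /rat_in_itvoo[a] : x < x + d by rewrite ltrDl.
rewrite in_itv/= => /andP[xa ad]; exists a.
  by rewrite ler_norml; apply/andP; split; lra.
pose s := ratr a - x.
have -> : ratr a = (s *: (x + 1) + (1 - s) *: x : R^o).
  by rewrite /s /GRing.scale/=; ring.
have s01 : 0 <= s <= 1 by rewrite /s; apply/andP; split; lra.
apply: (le_lt_trans (cg s (x + 1) x s01)).
rewrite -/M -(ltrD2r (- g x)).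
have -> : s * M + (1 - s) * g x - g x = s * (M - g x) by ring.
have s0 : 0 < s by rewrite /s; lra.
have sd : s < d by rewrite /s; lra.
have h1 : s * (M - g x) <= s * `|M - g x| by rewrite ler_pM2l// ler_norm.
apply: (le_lt_trans h1).
have h2 : s * (`|M - g x| + (c - g x)) < c - g x by rewrite -ltr_pdivlMr.
by apply: le_lt_trans h2; rewrite ler_pM2l// lerDl ltW.
Qed.

(** Otherwise [g <= c] at rationals on both sides of [x], hence at [x]. *)
Lemma convexf_above_rat (g : R^o -> R) (x c : R) : convexf g -> c < g x ->
  exists2 a : rat, `|ratr a - x| <= 1 & c < g (ratr a).
Proof.
move=> cg gx.
have /rat_in_itvoo[a] : x - 1 < x by lra.
have /rat_in_itvoo[b] : x < x + 1 by lra.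
rewrite !in_itv/= => /andP[xb bx] /andP[xa ax].
have [ga|ga] := ltP c (g (ratr a)).
  by exists a => //; rewrite ler_norml; apply/andP; split; lra.
exists b; first by rewrite ler_norml; apply/andP; split; lra.
rewrite ltNge; apply/negP => gb.
have ab : 0 < (ratr b - ratr a : R) by lra.
pose s := (x - ratr a) / (ratr b - ratr a) : R.
have s01 : 0 <= s <= 1.
  rewrite /s divr_ge0//=; [|lra|lra].
  by rewrite ler_pdivrMr// mul1r; lra.
have := cg s (ratr b) (ratr a) s01.
have -> : (s *: (ratr b : R^o) + (1 - s) *: (ratr a : R^o) : R^o) = x.
  by rewrite /s /GRing.scale/=; field; rewrite gt_eqF.
case/andP: s01 => s0 s1; nra.
Qed.

Section coordinates.
Context {D : nat}.
Implicit Types x z : 'rV[R]_D.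

Definition set_coord x (i : 'I_D) (a : R) : 'rV[R]_D :=
  \row_k (if k == i then a else x ord0 k).

Lemma set_coord_id x i : set_coord x i (x ord0 i) = x.
Proof. by apply/rowP => k; rewrite mxE; case: eqP => [->|]. Qed.

Lemma convexf_set_coord (f : 'rV[R]_D -> R) x i :
  convexf f -> convexf (fun a : R^o => f (set_coord x i a)).
Proof.
move=> cf t a b t01; apply: le_trans (cf t _ _ t01).
rewrite le_eqVlt; apply/orP; left; apply/eqP; congr f.
by apply/rowP => k; rewrite !mxE; case: eqP => // _; ring.
Qed.

(** Replacing the coordinates one after the other reduces density of rational
    points to the one-dimensional case; for convex functions this takes the place
    of continuity in several variables. *)
Lemma rational_approx (Q : 'rV[R]_D -> Prop) :
  (forall x i, Q x ->
     exists2 a : rat, `|ratr a - x ord0 i| <= 1 & Q (set_coord x i (ratr a))) ->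
  forall x, Q x -> exists2 y : 'rV[rat]_D,
    forall i, `|ratr (y ord0 i) - x ord0 i| <= 1 & Q (map_mx ratr y).
Proof.
move=> Qrat x Qx.
have step k : (k <= D)%N -> exists y : 'rV[R]_D,
  [/\ Q y, forall i : 'I_D, (i < k)%N -> exists a, y ord0 i = ratr a,
      forall i : 'I_D, (k <= i)%N -> y ord0 i = x ord0 i
    & forall i, `|y ord0 i - x ord0 i| <= 1].
  elim: k => [_|k IH kD].
    by exists x; split => // i; rewrite subrr normr0.
  have [y [Qy yrat yx y1]] := IH (ltnW kD).
  have [a ay Qa] := Qrat y (Ordinal kD) Qy.
  exists (set_coord y (Ordinal kD) (ratr a)); split => // i.
  - rewrite ltnS leq_eqVlt mxE -val_eqE/=; case: eqP => [_ _|_ /= ik].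
      by exists a.
    exact: yrat.
  - rewrite mxE -val_eqE/= => ki; rewrite gtn_eqF//.
    exact/yx/ltnW.
  - rewrite mxE; case: eqP => [->|//].
    by rewrite -yx.
have [y [Qy yrat _ y1]] := step D (leqnn D).
have /(@fin_all_exists _ _)[a ya] : forall i : 'I_D, exists a, y ord0 i = ratr a.
  by move=> i; apply: yrat.
have yE : y = map_mx ratr (\row_i a i) by apply/rowP => i; rewrite !mxE.
exists (\row_i a i); last by rewrite -yE.
by move=> i; rewrite mxE -ya.
Qed.

Lemma convexf_lt_rat (f : 'rV[R]_D -> R) x c : convexf f -> f x < c ->
  exists2 y : 'rV[rat]_D,
    forall i, `|ratr (y ord0 i) - x ord0 i| <= 1 & f (map_mx ratr y) < c.
Proof.
move=> cf; apply: (@rational_approx (fun x => f x < c)) => {}x i fx.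
by apply: convexf_below_rat (convexf_set_coord x i cf) _; rewrite set_coord_id.
Qed.

Lemma convexf_gt_rat (f : 'rV[R]_D -> R) x c : convexf f -> c < f x ->
  exists2 y : 'rV[rat]_D,
    forall i, `|ratr (y ord0 i) - x ord0 i| <= 1 & c < f (map_mx ratr y).
Proof.
move=> cf; apply: (@rational_approx (fun x => c < f x)) => {}x i fx.
by apply: convexf_above_rat (convexf_set_coord x i cf) _; rewrite set_coord_id.
Qed.

Definition dot x z : R := \sum_i x ord0 i * z ord0 i.

Lemma dotDr x y z : dot x (y + z) = dot x y + dot x z.
Proof. by rewrite /dot -big_split; apply: eq_bigr => i _; rewrite mxE mulrDr. Qed.

Lemma dotZr x a z : dot x (a *: z) = a * dot x z.
Proof. by rewrite /dot mulr_sumr; apply: eq_bigr => i _; rewrite mxE mulrCA. Qed.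

Lemma dotDl x y z : dot (x + y) z = dot x z + dot y z.
Proof. by rewrite /dot -big_split; apply: eq_bigr => i _; rewrite mxE mulrDl. Qed.

Lemma dotZl a x z : dot (a *: x) z = a * dot x z.
Proof. by rewrite /dot mulr_sumr; apply: eq_bigr => i _; rewrite mxE mulrA. Qed.

Lemma dotNr x z : dot x (- z) = - dot x z.
Proof. by rewrite -scaleN1r dotZr mulN1r. Qed.

Lemma dot_delta x i : dot x (delta_mx 0 i) = x ord0 i.
Proof.
rewrite /dot (bigD1 i)//= big1 => [|k /negPf ki]; rewrite !mxE ?eqxx/=.
  by rewrite mulr1 addr0.
by rewrite ki mulr0.
Qed.

(** Finite-dimensional Hahn-Banach: the slopes are found one coordinate at a time,
    each as the supremum of the left difference quotients in its direction. *)
Lemma convexf_subgradient (f : 'rV[R]_D -> R) z : convexf f ->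
  exists r, forall h, f z + dot r h <= f (z + h).
Proof.
move=> cf.
suff step k : (k <= D)%N -> exists r, forall h : 'rV[R]_D,
    (forall i : 'I_D, (k <= i)%N -> h ord0 i = 0) -> f z + dot r h <= f (z + h).
  have [r rh] := step D (leqnn D); exists r => h; apply: rh => i.
  by rewrite leqNgt ltn_ord.
elim: k => [_|k IH kD].
  exists 0 => h h0; have -> : h = 0 by apply/rowP => i; rewrite h0// mxE.
  by rewrite -(scale0r 0) dotZr mul0r scaler0 !addr0.
have [r rh] := IH (ltnW kD).
pose e : 'rV[R]_D := delta_mx 0 (Ordinal kD).
pose E := [set h : 'rV[R]_D | forall i : 'I_D, (k <= i)%N -> h ord0 i = 0].
pose lo (p : 'rV[R]_D * R) := (f z + dot r p.1 - f (z + (p.1 - p.2 *: e))) / p.2.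
pose S := [set lo p | p in [set p | E p.1 /\ 0 < p.2]].
(* Left slopes lie below right slopes: a suitable convex combination of the
   two points cancels [e]. *)
have slopes h t h' t' : E h -> 0 < t -> E h' -> 0 < t' ->
    lo (h, t) <= (f (z + (h' + t' *: e)) - f z - dot r h') / t'.
  move=> Eh t0 Eh' t'0; rewrite /lo/= ler_pdivrMr// mulrAC ler_pdivlMr//.
  have tt0 : 0 < t + t' by rewrite addr_gt0.
  pose s := t' / (t + t').
  have s01 : 0 <= s <= 1.
    rewrite /s divr_ge0//= ?(ltW t'0) ?(ltW tt0)//.
    by rewrite ler_pdivrMr// mul1r lerDr ltW.
  have := cf s (z + (h - t *: e)) (z + (h' + t' *: e)) s01.
  have -> : s *: (z + (h - t *: e)) + (1 - s) *: (z + (h' + t' *: e)) =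
            z + (s *: h + (1 - s) *: h').
    by apply/rowP => i; rewrite !mxE /s; field; rewrite gt_eqF.
  have Es : E (s *: h + (1 - s) *: h').
    by move=> i ki; rewrite !mxE Eh// Eh'// !mulr0 addr0.
  have := rh _ Es; rewrite dotDr !dotZr.
  set A := f (z + (h - _)); set B := f (z + (h' + _)).
  set F := f (z + (_ + _)); set a := dot r h; set b := dot r h'.
  move=> le1 le2; have := le_trans le1 le2.
  have -> : s = t' / (t + t') by [].
  have -> : 1 - t' / (t + t') = t / (t + t') by field; rewrite gt_eqF.
  rewrite -(ler_pM2r tt0).
  have -> : (f z + (t' / (t + t') * a + t / (t + t') * b)) * (t + t') =
    f z * (t + t') + t' * a + t * b by field; rewrite gt_eqF.
  have -> : (t' / (t + t') * A + t / (t + t') * B) * (t + t') = t' * A + t * B.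
    by field; rewrite gt_eqF.
  by lra.
have E0 : E 0 by move=> i _; rewrite mxE.
have S0 : S !=set0 by exists (lo (0, 1)); exists (0, 1).
have ubS h' t' : E h' -> 0 < t' ->
    ubound S ((f (z + (h' + t' *: e)) - f z - dot r h') / t').
  by move=> Eh' t'0 _ [[h t] [/= Eh t0] <-]; exact: slopes.
have supS : has_sup S.
  by split => //; exists ((f (z + (0 + 1 *: e)) - f z - dot r 0) / 1); exact: ubS.
pose s := sup S.
exists (r + (s - r ord0 (Ordinal kD)) *: e) => h h0.
pose t := h ord0 (Ordinal kD); pose h' := h - t *: e.
have Eh' : E h'.
  move=> i; rewrite !mxE eqxx/= -val_eqE/= leq_eqVlt.
  case: (eqVneq (i : nat) k) => [ik _|ik].
    have -> : i = Ordinal kD by apply: val_inj.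
    by rewrite -/t mulr1 subrr.
  by move=> /= /h0 ->; rewrite mulr0 subr0.
have hE : h = h' + t *: e by rewrite /h' subrK.
clearbody h'.
have -> : dot (r + (s - r ord0 (Ordinal kD)) *: e) h = dot r h' + t * s.
  have h'k : dot e h' = 0.
    rewrite /dot (bigD1 (Ordinal kD))//= (Eh' (Ordinal kD))// mulr0 add0r.
    by rewrite big1// => i /negPf ik; rewrite !mxE ik andbF mul0r.
  rewrite hE dotDl dotZl !dotDr !dotZr h'k !dot_delta mxE !eqxx/=.
  ring.
have [t0|t0|t0] := ltgtP t 0.
- have : lo (h', - t) <= s by apply: ub_le_sup => //; [exact: supS.2|exists (h', - t)];
    rewrite //=; split=> //; rewrite oppr_gt0.
  rewrite /lo/= ler_pdivrMr ?oppr_gt0// scaleNr opprK -hE; lra.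
- have : s <= (f (z + (h' + t *: e)) - f z - dot r h') / t.
    by apply: ge_sup => //; exact: ubS.
  rewrite ler_pdivlMr// -hE; lra.
- have -> : h = h' by rewrite hE t0 scale0r addr0.
  by rewrite t0 mul0r addr0; exact: rh.
Qed.

Definition sqnorm x : R := \sum_i x ord0 i ^+ 2.

Lemma sqnorm_ge0 x : 0 <= sqnorm x.
Proof. by apply: sumr_ge0 => i _; exact: sqr_ge0. Qed.

Lemma convexf_sqnorm eps : 0 <= eps -> convexf (fun x => eps * sqnorm x).
Proof.
move=> e0 t x y /andP[t0 t1].
rewrite [leRHS](_ : _ = eps * (t * sqnorm x + (1 - t) * sqnorm y)); last ring.
rewrite ler_wpM2l//.
rewrite /sqnorm !mulr_sumr -big_split/=; apply: ler_sum => i _.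
rewrite !mxE; set a := x _ _; set b := y _ _.
have : 0 <= t * (1 - t) * (a - b) ^+ 2.
  by rewrite mulr_ge0 ?sqr_ge0// mulr_ge0// subr_ge0.
nra.
Qed.

Lemma convexf_affine (a : 'rV[R]_D) (b : R) : convexf (fun x => - (dot a x + b)).
Proof. by move=> t x y t01; rewrite dotDr !dotZr; lra. Qed.

(** The supporting hyperplane of [f + eps |.|^2] at [z] has a real slope [s]. Since
    [eps |x - z|^2] is left over below the graph, moving [s] to a rational slope
    costs only a constant, by [w u <= eps u^2 + w^2 / (4 eps)] in each
    coordinate. *)
Lemma rational_affine_minorant (f : 'rV[R]_D -> R) z (eps eta : R) :
  convexf f -> 0 < eps -> 0 < eta ->
  exists ab : 'rV[rat]_D * rat,
    (forall x, dot (map_mx ratr ab.1) x + ratr ab.2 <= f x + eps * sqnorm x) /\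
    f z + eps * sqnorm z - eta < dot (map_mx ratr ab.1) z + ratr ab.2.
Proof.
move=> cf e0 n0; have [r rh] := convexf_subgradient z cf.
pose s := r + (2 * eps) *: z.
(* This choice makes D * del ^+ 2 / (4 * eps) at most eta / 2. *)
pose del := Num.min 1 (2 * eps * eta / (D.+1)%:R).
have del0 : 0 < del by rewrite lt_min ltr01/= divr_gt0// !mulr_gt0.
have /(@fin_all_exists _ _)[a aE] : forall i : 'I_D,
    exists a : rat, s ord0 i < ratr a < s ord0 i + del.
  move=> i; have /rat_in_itvoo[a] : s ord0 i < s ord0 i + del by rewrite ltrDl.
  by rewrite in_itv/= => ai; exists a.
pose A : 'rV[R]_D := map_mx ratr (\row_i a i).
pose v := f z + eps * sqnorm z - dot A z.
have /rat_in_itvoo[b] : v - eta < v - eta / 2 by lra.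
rewrite in_itv/= => /andP[b1 b2].
exists (\row_i a i, b); split => /=; rewrite -/A; last by rewrite /v in b1; lra.
move=> x; have := rh (x - z); rewrite (addrC z) subrK => fx.
have main : dot A (x - z) - eta / 2 <= dot s (x - z) + eps * sqnorm (x - z).
  have Dd : D%:R * (del ^+ 2 / (4 * eps)) <= eta / 2.
    have d1 : del <= 1 by rewrite ge_min lexx.
    have d2 : del * D.+1%:R <= 2 * eps * eta.
      by rewrite -ler_pdivlMr// ge_min lexx orbT.
    rewrite mulrA ler_pdivrMr ?mulr_gt0//.
    apply: (@le_trans _ _ (del * D.+1%:R)); last by lra.
    rewrite mulrC expr2 -mulrA ler_pM2l//.
    rewrite (@le_trans _ _ (1 * D%:R))// ?ler_wpM2r// mul1r ler_nat.
    exact: leqnSn.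
  suff : dot A (x - z) <= dot s (x - z) + eps * sqnorm (x - z)
                          + D%:R * (del ^+ 2 / (4 * eps)) by lra.
  have -> : D%:R * (del ^+ 2 / (4 * eps)) =
            \sum_(i < D) (del ^+ 2 / (4 * eps)).
    by rewrite sumr_const card_ord mulr_natl.
  rewrite /dot /sqnorm mulr_sumr -!big_split/=; apply: ler_sum => i _.
  rewrite !mxE; have /andP[a1 a2] := aE i; rewrite /s !mxE in a1 a2.
  set u := x _ _ - z _ _; set w := ratr (a i) - (r ord0 i + 2 * eps * z ord0 i).
  have w2 : w ^+ 2 <= del ^+ 2.
    by rewrite ler_pXn2r ?nnegrE// ?(ltW del0)// /w; lra.
  have : 0 <= (2 * eps * u - w) ^+ 2 by exact: sqr_ge0.
  have -> : ratr (a i) = w + (r ord0 i + 2 * eps * z ord0 i) by rewrite /w subrK.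
  move=> sq; have : w * u <= eps * u ^+ 2 + w ^+ 2 / (4 * eps).
    rewrite -(ler_pM2r (_ : 0 < 4 * eps)) ?mulr_gt0//.
    have -> : (eps * u ^+ 2 + w ^+ 2 / (4 * eps)) * (4 * eps) =
      4 * eps ^+ 2 * u ^+ 2 + w ^+ 2 by field; rewrite gt_eqF.
    by nra.
  have : w ^+ 2 / (4 * eps) <= del ^+ 2 / (4 * eps).
    by rewrite ler_pM2r// invr_gt0 mulr_gt0.
  by lra.
have -> : sqnorm x = sqnorm z + 2 * dot z (x - z) + sqnorm (x - z).
  rewrite /sqnorm /dot mulr_sumr -!big_split/=; apply: eq_bigr => i _.
  by rewrite !mxE; ring.
move: main; rewrite /s dotDl dotZl.
have -> : dot A (x - z) = dot A x - dot A z by rewrite dotDr dotNr.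
move: b2; rewrite /v; nra.
Qed.

(** If [f (z + t v) > f z], convexity forces [f] to grow at least linearly along
    [z + s v], whereas [z + s v] is the midpoint of [2 z] and [2 s v], so that [f]
    stays bounded along it at half-integer [s]. *)
Lemma recession_direction (f : 'rV[R]_D -> R) (v : 'rV[R]_D) :
  convexf f -> (forall n : nat, f (n%:R *: v) <= f 0) ->
  forall z t, 0 <= t -> f (z + t *: v) <= f z.
Proof.
move=> cf fv z t; rewrite le_eqVlt => /predU1P[<-|t0].
  by rewrite scale0r addr0.
rewrite leNgt; apply/negP => fzt.
pose dl := f (z + t *: v) - f z; have dl0 : 0 < dl by rewrite subr_gt0.
pose C := (f (2 *: z) + f 0) / 2.
(* The first bound puts t below s = n / 2, the second makes the linear lower
   bound at s exceed C. *)
have [n nE] : exists n : nat, Num.max (2 * t) (2 * t * (C - f z) / dl) < n%:R.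
  set m := Num.max _ _; exists (Num.bound `|m|).
  exact: le_lt_trans (ler_norm m) (archi_boundP (normr_ge0 m)).
move: nE; rewrite gt_max => /andP[n1 n2].
pose s := n%:R / 2 : R.
have st : t < s by rewrite /s; lra.
have s0 : 0 < s by lra.
have ub : f (z + s *: v) <= C.
  have := cf 2^-1 (2 *: z) (n%:R *: v).
  have -> : 2^-1 *: (2 *: z) + (1 - 2^-1) *: (n%:R *: v) = z + s *: v.
    by apply/rowP => i; rewrite !mxE /s; field.
  move=> /(_ _)/le_trans; apply; first by apply/andP; split; lra.
  by have := fv n; rewrite /C; lra.
have lb : f z + s / t * dl <= f (z + s *: v).
  have ts01 : 0 <= t / s <= 1.
    by rewrite divr_ge0 ?(ltW t0) ?(ltW s0)//= ler_pdivrMr// mul1r ltW.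
  have := cf (t / s) (z + s *: v) z ts01.
  have -> : (t / s) *: (z + s *: v) + (1 - t / s) *: z = z + t *: v.
    by apply/rowP => i; rewrite !mxE; field; rewrite gt_eqF.
  have -> : f (z + t *: v) = f z + dl by rewrite /dl; ring.
  rewrite -(ler_pM2l (divr_gt0 s0 t0)).
  have -> : s / t * (t / s * f (z + s *: v) + (1 - t / s) * f z) =
    f (z + s *: v) + s / t * f z - f z by field; rewrite !gt_eqF.
  by lra.
have : C - f z < s / t * dl.
  rewrite /s -(ltr_pM2r (_ : 0 < 2 * t / dl)) ?divr_gt0 ?mulr_gt0//.
  have -> : n%:R / 2 / t * dl * (2 * t / dl) = n%:R by field; rewrite !gt_eqF.
  apply: le_lt_trans n2; rewrite le_eqVlt; apply/orP; left; apply/eqP; ring.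
by have := le_trans lb ub; lra.
Qed.

Definition l1norm x : R := \sum_i `|x ord0 i|.

Lemma enorm_le_l1norm x : enorm x <= l1norm x.
Proof.
rewrite /enorm /l1norm -[leRHS]ger0_norm ?sumr_ge0// -[leRHS]sqrtr_sqr.
apply: ler_wsqrtr.
suff [] : 0 <= \sum_i `|x ord0 i| /\
  \sum_i x ord0 i ^+ 2 <= (\sum_i `|x ord0 i|) ^+ 2 by [].
apply: (big_rec2 (fun a b : R => 0 <= b /\ a <= b ^+ 2)) => [|i a b _ [b0 ab]].
  by rewrite expr0n.
split; first by rewrite addr_ge0.
by rewrite sqrrD real_normK ?num_real// -addrA lerD2l -[a]add0r lerD// mulrn_wge0// mulr_ge0.
Qed.

Lemma coord_le_enorm x i : `|x ord0 i| <= enorm x.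
Proof.
rewrite -sqrtr_sqr /enorm ler_wsqrtr// (bigD1 i)//= lerDl.
by apply: sumr_ge0 => k _; exact: sqr_ge0.
Qed.

(** A growth condition that holds almost surely at each deterministic point
    gives a single null set for the rational points; convexity then extends the
    bound to all points, with a shift by the size of a unit cube. *)
Lemma convexf_growth (f : 'rV[R]_D -> R) (A q : R) : convexf f -> 0 <= A -> 0 <= q ->
  (forall y : 'rV[rat]_D, `|f (map_mx ratr y)| <= A * (1 + enorm (map_mx ratr y) `^ q)) ->
  forall x, `|f x| <= A * (1 + (D%:R + l1norm x) `^ q).
Proof.
move=> cf A0 q0 fy x; set B := A * _.
have near (y : 'rV[rat]_D) : (forall i, `|ratr (y ord0 i) - x ord0 i| <= 1) ->
    `|f (map_mx ratr y)| <= B.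
  move=> yx; apply: (le_trans (fy y)); rewrite /B ler_wpM2l// lerD2l.
  have enn : 0 <= enorm (map_mx ratr y : 'rV[R]_D) by rewrite sqrtr_ge0.
  apply: ge0_ler_powR => //; rewrite ?nnegrE//.
    by rewrite addr_ge0// sumr_ge0.
  apply: (le_trans (enorm_le_l1norm _)).
  have -> : D%:R = \sum_(i < D) 1 :> R by rewrite sumr_const card_ord.
  rewrite /l1norm -big_split/=; apply: ler_sum => i _.
  by rewrite mxE -lerBlDr (le_trans (lerB_dist _ _))//.
rewrite leNgt; apply/negP; rewrite ltr_normr => /orP[|] h.
  have [y /near + ] := convexf_gt_rat cf h.
  by rewrite ler_norml => /andP[_] /le_lt_trans/[apply]; rewrite ltxx.
have /(convexf_lt_rat cf)[y /near] : f x < - B by rewrite ltrNr.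
by rewrite ler_norml => /andP[+ _] => /le_lt_trans/[apply]; rewrite ltxx.
Qed.

End coordinates.
End convex_functions.

(** * Random variables with all moments, and sub-sigma-algebras *)

Section moments.
Context {R : realType} {d : measure_display} {T : measurableType d}.
Variable P : probability T R.
Implicit Types X Y : T -> R.

Lemma measurable_powR_norm X p : measurable_fun setT X ->
  measurable_fun setT (fun w => `|X w| `^ p : R).
Proof.
by move=> mX; apply: (measurableT_comp (measurable_powR _));
  exact: measurableT_comp.
Qed.

Lemma LinfmP X : Linfm P X <-> measurable_fun setT X /\
  forall p, 1 <= p -> P.-integrable setT (fun w => (`|X w| `^ p)%:E).
Proof.
split=> [LX|[mX iX] p p1].
  split=> [|p p1]; last exact/Lfun_integrable/LX.
  by have := LX 1 (lexx _); rewrite inE => /andP[/[!inE]].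
rewrite inE; apply/andP; split; rewrite inE//=.
rewrite /finite_norm unlock /Lnorm poweR_lty//.
by have /integrable_lty := iX p p1; exact.
Qed.

Lemma Linfm_measurable X : Linfm P X -> measurable_fun setT X.
Proof. by case/LinfmP. Qed.

Lemma Linfm_integrable X : Linfm P X -> P.-integrable setT (EFin \o X).
Proof. by move=> /(_ 1 (lexx _)) /Lfun1_integrable. Qed.

Lemma Linfm_cst c : Linfm P (cst c).
Proof. by move=> p p1; exact: Lfun_cst. Qed.

Lemma LinfmD X Y : Linfm P X -> Linfm P Y -> Linfm P (fun w => X w + Y w).
Proof.
move=> LX LY p p1; have p1E : (1 <= p%:E)%E by rewrite lee_fin.
have := Lfun_submod_closed P p1E => -[_ /(_ 1 X Y (LX p p1) (LY p p1))].
by rewrite scale1r.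
Qed.

Lemma LinfmZ a X : Linfm P X -> Linfm P (fun w => a * X w).
Proof.
move=> LX p p1; have p1E : (1 <= p%:E)%E by rewrite lee_fin.
have := Lfun_submod_closed P p1E => -[L0 /(_ a X 0 (LX p p1) L0)].
by rewrite addr0.
Qed.

Lemma LinfmB X Y : Linfm P X -> Linfm P Y -> Linfm P (fun w => X w - Y w).
Proof.
move=> LX /(LinfmZ (-1)) LY; have := LinfmD LX LY.
by under eq_fun do rewrite mulN1r.
Qed.

Lemma Linfm_sum (I : Type) (s : seq I) (X : I -> T -> R) :
  (forall i, Linfm P (X i)) -> Linfm P (fun w => \sum_(i <- s) X i w).
Proof.
move=> LX; elim: s => [|i s IH].
  by under eq_fun do rewrite big_nil; exact: Linfm_cst.
by under eq_fun do rewrite big_cons; exact: LinfmD.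
Qed.

Lemma Linfm_le X Y : measurable_fun setT X -> Linfm P Y ->
  {ae P, forall w, `|X w| <= Y w} -> Linfm P X.
Proof.
move=> mX /LinfmP[mY iY] XY; apply/LinfmP; split => // p p1.
apply/integrableP; split; first exact/measurable_EFinP/measurable_powR_norm.
have /integrableP[_] := iY p p1; apply: le_lt_trans.
apply: ae_ge0_le_integral => //; [exact/measurableT_comp/measurable_EFinP/measurable_powR_norm..|].
apply: filterS XY => w XY _ /=.
rewrite lee_fin !(ger0_norm (powR_ge0 _ _)).
apply: ge0_ler_powR; rewrite ?nnegrE//; first exact: le_trans p1.
by rewrite (le_trans XY) ?ler_norm.
Qed.

(** For exponents [q p < 1] one uses [x^(q p) <= 1 + x^(q p + 1)]. *)
Lemma Linfm_powR X q : 0 <= q -> Linfm P X -> Linfm P (fun w => `|X w| `^ q).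
Proof.
move=> q0 LX; have /LinfmP[mX iX] := LX.
apply/LinfmP; split => [|p p1]; first exact: measurable_powR_norm.
have qp0 : 0 <= q * p by rewrite mulr_ge0// (le_trans ler01).
apply: (@le_integrable _ _ _ P setT _ _ (fun w => (1 + `|X w| `^ (q * p + 1))%:E)) => //.
- exact/measurable_EFinP/measurable_powR_norm/measurable_powR_norm.
- move=> w _; rewrite !abse_EFin lee_fin !(ger0_norm (powR_ge0 _ _)).
  rewrite (ger0_norm (addr_ge0 _ (powR_ge0 _ _)))//.
  rewrite -powRrM; have [X1|X1] := leP `|X w| 1.
    rewrite (@le_trans _ _ 1) ?lerDl ?powR_ge0//.
    have := @ge0_ler_powR _ (q * p) qp0 `|X w| 1.
    by rewrite !nnegrE normr_ge0 ler01 powR1; apply.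
  apply: (@le_trans _ _ (`|X w| `^ (q * p + 1))); last by rewrite lerDr.
  by apply: ler_powR; [exact: ltW|rewrite lerDl].
- under eq_fun do rewrite EFinD.
  apply: integrableD => //; first exact: finite_measure_integrable_cst.
  by apply: iX; rewrite lerDr.
Qed.

Lemma Linfm_sqr X : Linfm P X -> Linfm P (fun w => X w ^+ 2).
Proof.
move=> /(@Linfm_powR _ 2 (ler0n _ _)).
by under eq_fun do rewrite powR_mulrn// real_normK ?num_real//.
Qed.

Lemma LinfmM X Y : Linfm P X -> Linfm P Y -> Linfm P (fun w => X w * Y w).
Proof.
move=> LX LY; apply: (Linfm_le _ (LinfmD (Linfm_sqr LX) (Linfm_sqr LY))).
  by apply: measurable_funM; exact: Linfm_measurable.
apply: nearW => w; rewrite ler_norml.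
have := sqr_ge0 (X w - Y w); have := sqr_ge0 (X w + Y w).
have := sqr_ge0 (X w); have := sqr_ge0 (Y w).
by move=> *; apply/andP; split; nra.
Qed.

Lemma Linfm_rV_coord (m : nat) (X : T -> 'rV[R]_m) i :
  Linfm_rV P X -> measurable_fun setT (fun w => X w ord0 i) ->
  Linfm P (fun w => X w ord0 i).
Proof.
move=> [_ LX] mX; apply: (Linfm_le mX LX).
by apply: nearW => w; exact: coord_le_enorm.
Qed.

End moments.

Section measurability.
Context {R : realType} {d : measure_display} {T : measurableType d}.
Variable G : set (set T).
Hypotheses (sG : sigma_algebra setT G) (GM : G `<=` measurable).
Notation TG := (g_sigma_algebraType G).

Lemma G_measurableE (A : set T) : measurable (A : set TG) = G A.
Proof. by rewrite (measurable_g_measurableTypeE sG). Qed.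

Lemma measurable_wrtW (X : T -> R) : measurable_wrt G X -> measurable_fun setT X.
Proof.
move=> mX _ B mB; apply: GM; rewrite -G_measurableE.
exact: (mX measurableT B mB).
Qed.

Lemma measurable_wrt_lt (X Y : T -> R) : measurable_wrt G X -> measurable_wrt G Y ->
  G [set w | X w < Y w].
Proof.
move=> mX mY; rewrite -G_measurableE.
have mtrue : measurable [set true] by [].
have := measurable_fun_ltr mX mY measurableT mtrue.
by rewrite setTI; congr measurable; apply/seteqP; split => w /=.
Qed.

Lemma measurable_wrt_le (X Y : T -> R) : measurable_wrt G X -> measurable_wrt G Y ->
  G [set w | X w <= Y w].
Proof.
move=> mX mY; rewrite -G_measurableE.
have mtrue : measurable [set true] by [].
have := measurable_fun_ler mX mY measurableT mtrue.
by rewrite setTI; congr measurable; apply/seteqP; split => w /=.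
Qed.

Lemma measurable_wrt_gtP (X : T -> R) : (forall c, G [set w | c < X w]) ->
  measurable_wrt G X.
Proof.
move=> GX mT; apply: (measurability _ (RGenOInfty.measurableE R)) => //.
move=> /= _ [_ [a ->] <-]; rewrite preimage_itvoy setTI.
by rewrite [X in X _](_ : _ = G) //; apply/funext => A; rewrite G_measurableE.
Qed.

Lemma measurable_wrtD (X Y : T -> R) : measurable_wrt G X -> measurable_wrt G Y ->
  measurable_wrt G (fun w => X w + Y w).
Proof. exact: measurable_funD. Qed.

Lemma measurable_wrtM (X Y : T -> R) : measurable_wrt G X -> measurable_wrt G Y ->
  measurable_wrt G (fun w => X w * Y w).
Proof. exact: measurable_funM. Qed.

Lemma measurable_wrtB (X Y : T -> R) : measurable_wrt G X -> measurable_wrt G Y ->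
  measurable_wrt G (fun w => X w - Y w).
Proof. exact: measurable_funB. Qed.

Lemma measurable_wrt_cst (c : R) : measurable_wrt G (cst c).
Proof. exact: measurable_cst. Qed.

Lemma measurable_wrt_sum (I : Type) (s : seq I) (X : I -> T -> R) :
  (forall i, measurable_wrt G (X i)) ->
  measurable_wrt G (fun w => \sum_(i <- s) X i w).
Proof. exact: measurable_sum. Qed.

Lemma sigma_algebraI A B : G A -> G B -> G (A `&` B).
Proof. by rewrite -!G_measurableE; exact: measurableI. Qed.

Lemma sigma_algebra_bigcup_countable (I : countType) (A : I -> set T) :
  (forall i, G (A i)) -> G (\bigcup_i A i).
Proof.
move=> GA; rewrite -G_measurableE; apply: countable_bigcupT_measurable => // i.
by rewrite G_measurableE.
Qed.

Lemma sigma_algebra_bigcap_countable (I : countType) (A : I -> set T) :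
  (forall i, G (A i)) -> G (\bigcap_i A i).
Proof.
move=> GA; rewrite -[X in G X]setCK setC_bigcap -G_measurableE.
apply: measurableC; apply: countable_bigcupT_measurable => // i.
by apply: measurableC; rewrite G_measurableE.
Qed.

End measurability.

Lemma ae_forall_countable (d : measure_display) (T : measurableType d) (R : realType)
    (mu : {measure set T -> \bar R}) (I : countType) (Q : I -> T -> Prop) :
  (forall i, {ae mu, forall w, Q i w}) -> {ae mu, forall w, forall i, Q i w}.
Proof.
move=> aeQ.
have : {ae mu, forall w, forall n, if unpickle n is Some i then Q i w else True}.
  by apply: ae_foralln => n; case: unpickle => [i|]; [exact: aeQ|exact: nearW].
by apply: filterS => w Qw i; have := Qw (pickle i); rewrite pickleK.
Qed.

(** * Conditional expectation *)

Section conditional_expectation.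
Context {R : realType} {d : measure_display} {T : measurableType d}.
Variables (P : probability T R) (G : set (set T)).
Hypotheses (sG : sigma_algebra setT G) (GM : G `<=` measurable).
Implicit Types X Y Z W B : T -> R.

Let integrableT X A : G A -> P.-integrable setT (EFin \o X) ->
  P.-integrable A (EFin \o X).
Proof. by move=> GA; apply: integrableS => //; exact: GM. Qed.

Lemma is_condexp_refl Z : measurable_wrt G Z -> P.-integrable setT (EFin \o Z) ->
  is_condexp P G Z Z.
Proof. by split. Qed.

Lemma is_condexpD X Y Z W :
  P.-integrable setT (EFin \o X) -> P.-integrable setT (EFin \o Y) ->
  is_condexp P G X Z -> is_condexp P G Y W ->
  is_condexp P G (fun w => X w + Y w) (fun w => Z w + W w).
Proof.
move=> iX iY [mZ iZ XZ] [mW iW YW]; split.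
- exact: measurable_wrtD.
- have := integrableD measurableT iZ iW; exact: eq_integrable.
- move=> A GA.
  rewrite [LHS](_ : _ = \int[P]_(w in A) ((EFin \o Z) w + (EFin \o W) w))%E//.
  rewrite [RHS](_ : _ = \int[P]_(w in A) ((EFin \o X) w + (EFin \o Y) w))%E//.
  by rewrite !integralD ?XZ ?YW//; try exact: GM; exact: integrableT.
Qed.

Lemma is_condexpZ a X Z : P.-integrable setT (EFin \o X) ->
  is_condexp P G X Z -> is_condexp P G (fun w => a * X w) (fun w => a * Z w).
Proof.
move=> iX [mZ iZ XZ]; split.
- by apply: measurable_wrtM => //; exact: measurable_wrt_cst.
- have := integrableZl measurableT a iZ; exact: eq_integrable.
- move=> A GA.
  rewrite [LHS](_ : _ = \int[P]_(w in A) (a%:E * (EFin \o Z) w))%E//.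
  rewrite [RHS](_ : _ = \int[P]_(w in A) (a%:E * (EFin \o X) w))%E//.
  by rewrite !integralZl//= ?XZ//; try exact: GM; exact: integrableT.
Qed.

Lemma is_condexpB X Y Z W :
  P.-integrable setT (EFin \o X) -> P.-integrable setT (EFin \o Y) ->
  is_condexp P G X Z -> is_condexp P G Y W ->
  is_condexp P G (fun w => X w - Y w) (fun w => Z w - W w).
Proof.
move=> iX iY XZ YW.
have iNY : P.-integrable setT (EFin \o (fun w => -1 * Y w)).
  have := integrableZl measurableT (-1) iY; exact: eq_integrable.
have := is_condexpD iX iNY XZ (is_condexpZ (-1) iY YW).
by under eq_fun do rewrite mulN1r; under [X in is_condexp _ _ _ X]eq_fun do rewrite mulN1r.
Qed.

Lemma is_condexp_sum (I : Type) (s : seq I) (X Z : I -> T -> R) :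
  (forall i, P.-integrable setT (EFin \o X i)) ->
  (forall i, is_condexp P G (X i) (Z i)) ->
  is_condexp P G (fun w => \sum_(i <- s) X i w) (fun w => \sum_(i <- s) Z i w).
Proof.
move=> iX XZ; elim: s => [|i s IH].
  have -> : (fun w => \sum_(i <- [::]) X i w) = cst 0.
    by apply/funext => w; rewrite big_nil.
  have -> : (fun w => \sum_(i <- [::]) Z i w) = cst 0.
    by apply/funext => w; rewrite big_nil.
  apply: is_condexp_refl; first exact: measurable_wrt_cst.
  exact: finite_measure_integrable_cst.
have isum : P.-integrable setT (EFin \o (fun w => \sum_(i <- s) X i w)).
  rewrite (_ : _ \o _ = (fun w => \sum_(i <- s) (EFin \o X i) w)%E); last first.
    by apply/funext => w /=; rewrite sumEFin.
  by apply: integrable_sum => // k _; exact: iX.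
under eq_fun do rewrite big_cons.
under [X in is_condexp _ _ _ X]eq_fun do rewrite big_cons.
exact: is_condexpD.
Qed.

Lemma is_condexp_tower H X Z W : H `<=` G ->
  is_condexp P G X Z -> is_condexp P H Z W -> is_condexp P H X W.
Proof.
move=> HG [_ _ XZ] [mW iW ZW]; split => // A HA.
by rewrite ZW// XZ//; exact: HG.
Qed.

(** The event that the inequality between the versions fails inside [A] belongs
    to [G]; integrating over it shows that it is negligible. The localisation to
    [A] is what allows [G]-measurable data to be treated as constants. *)
Lemma is_condexp_le_on A X Y Z W : G A ->
  P.-integrable setT (EFin \o X) -> P.-integrable setT (EFin \o Y) ->
  is_condexp P G X Z -> is_condexp P G Y W ->
  {ae P, forall w, A w -> X w <= Y w} -> {ae P, forall w, A w -> Z w <= W w}.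
Proof.
move=> GA iX iY [mZ iZ XZ] [mW iW YW] XY.
pose N := A `&` [set w | W w < Z w].
have GN : G N by apply: sigma_algebraI => //; exact: measurable_wrt_lt.
have mN : measurable N by exact: GM.
have mX := measurable_int _ iX; have mY := measurable_int _ iY.
have ZW : (\int[P]_(w in N) (Z w)%:E <= \int[P]_(w in N) (W w)%:E)%E.
  rewrite XZ// YW//.
  (* The maximum is Y almost surely on A and dominates X everywhere. *)
  have iXY : P.-integrable setT (EFin \o (fun w => Num.max (X w) (Y w))).
    apply: (le_integrable measurableT _ _
      (integrableD measurableT (integrable_abse iX) (integrable_abse iY))).
      by apply/measurable_EFinP; apply: measurable_maxr; exact/measurable_EFinP.
    move=> w _ /=; rewrite lee_fin [leRHS]ger0_norm ?addr_ge0//.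
    by rewrite /Order.max; case: ifP => _; rewrite ?lerDl ?lerDr.
  apply: (@le_trans _ _ (\int[P]_(w in N) (Num.max (X w) (Y w))%:E)%E).
    apply: le_integral => //; [exact: integrableT|exact: integrableT|].
    by move=> w _; rewrite lee_fin le_max lexx.
  rewrite le_eqVlt; apply/orP; left; apply/eqP.
  apply: ae_eq_integral => //.
  - exact/measurable_funTS/(measurable_int _ iXY).
  - exact/measurable_funTS.
  - apply: filterS XY => w XY [Aw _]; congr EFin.
    exact/max_idPr/XY.
have int0 : (\int[P]_(w in N) `|(EFin \o (fun w => Z w - W w)%R) w| = 0)%E.
  apply/eqP; rewrite eq_le integral_ge0// andbT.
  rewrite (_ : integral _ _ _ = \int[P]_(w in N) ((EFin \o Z) w - (EFin \o W) w))%E.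
    rewrite integralB//; [|exact: integrableT|exact: integrableT].
    have fW : (\int[P]_(w in N) (W w)%:E)%E \is a fin_num.
      by apply: integrable_fin_num => //; exact: integrableT.
    by rewrite leeBlDr// add0e.
  apply: eq_integral => w; rewrite inE => -[_ /= ZWw].
  by rewrite -EFinB ger0_norm// subr_ge0 ltW.
have mZW : measurable_fun N (EFin \o (fun w => Z w - W w)).
  apply: measurable_funTS; apply/measurable_EFinP.
  by apply: measurable_funB; exact: (measurable_wrtW sG GM).
have := (ae_eq_integral_abs P mN mZW).1 int0.
apply: filterS => w Nw Aw; rewrite leNgt; apply/negP => ZWw.
have [/eqP] := Nw (conj Aw ZWw); rewrite subr_eq0 => /eqP ZWe.
by rewrite ZWe ltxx in ZWw.
Qed.

Lemma is_condexp_le X Y Z W :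
  P.-integrable setT (EFin \o X) -> P.-integrable setT (EFin \o Y) ->
  is_condexp P G X Z -> is_condexp P G Y W ->
  {ae P, forall w, X w <= Y w} -> {ae P, forall w, Z w <= W w}.
Proof.
move=> iX iY XZ YW XY.
have GT : G setT by case: sG => G0 GC _; rewrite -(setD0 setT); exact: GC.
have := is_condexp_le_on GT iX iY XZ YW.
move=> /(_ (filterS (fun w h _ => h) XY)).
by apply: filterS => w; exact.
Qed.

Lemma is_condexp_eq X Y Z W :
  P.-integrable setT (EFin \o X) -> P.-integrable setT (EFin \o Y) ->
  is_condexp P G X Z -> is_condexp P G Y W ->
  {ae P, forall w, X w = Y w} -> {ae P, forall w, Z w = W w}.
Proof.
move=> iX iY XZ YW XY.
have XleY : {ae P, forall w, X w <= Y w} by apply: filterS XY => w ->.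
have YleX : {ae P, forall w, Y w <= X w} by apply: filterS XY => w ->.
apply: filterS2 (is_condexp_le iX iY XZ YW XleY) (is_condexp_le iY iX YW XZ YleX).
by move=> w ZW WZ; apply/le_anti; rewrite ZW WZ.
Qed.

(** Radon-Nikodym derivative of the charge [A |-> \int_A X dP] with respect to
    [P], both restricted to [G]. *)
Lemma is_condexp_ex X : P.-integrable setT (EFin \o X) ->
  exists Z, is_condexp P G X Z.
Proof.
move=> iX; pose TG := g_sigma_algebraType G.
have mid : measurable_fun setT (id : T -> TG).
  by move=> _ B mB; rewrite setTI; apply: GM; rewrite -(G_measurableE sG).
(* The restriction of P to G is the law of the identity map into TG. *)
pose idG : {mfun T >-> TG} := HB.pack (id : T -> TG) (isMeasurableFun.Build _ _ _ _ _ mid).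
pose PG : probability TG R := distribution P idG.
pose nu (A : set TG) := induced_charge iX A.
have mG (A : set TG) : measurable A -> measurable (A : set T).
  by rewrite (G_measurableE sG) => /GM.
have nu0 : nu set0 = 0%E by exact: charge0.
have finnu A : measurable A -> nu A \is a fin_num.
  by move=> /mG mA; exact: fin_num_measure.
have snu : semi_sigma_additive nu.
  move=> F mF tF mUF; apply: charge_semi_sigma_additive => //.
    by move=> n; exact: mG.
  exact: mG.
pose nuC : {charge set TG -> \bar R} :=
  HB.pack nu (isCharge.Build _ TG R nu nu0 finnu snu).
have dom : nuC `<< PG.
  apply/null_content_dominatesP => A mA PA0.
  rewrite /= /nu /induced_charge null_set_integral//; first exact: mG.
  exact/measurable_funTS/(measurable_int _ iX).
pose f := fine \o Radon_Nikodym nuC PG.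
have fE w : ((f w)%:E = Radon_Nikodym nuC PG w)%E.
  by rewrite /f /= fineK// Radon_Nikodym_fin_num.
have mf : measurable_fun [set: TG] (f : TG -> R).
  apply/measurable_EFinP; rewrite (_ : _ \o _ = Radon_Nikodym nuC PG); last first.
    by apply/funext => w; rewrite /= fE.
  exact: (measurable_int PG (Radon_Nikodym_integrable dom)).
have mfE : measurable_fun [set: TG] (EFin \o (f : TG -> R)).
  exact/measurable_EFinP.
have iPG : PG.-integrable [set: TG] (EFin \o (f : TG -> R)).
  apply: eq_integrable (Radon_Nikodym_integrable dom) => // w _.
  by rewrite /= fE.
have if_ : P.-integrable setT (EFin \o f).
  apply/integrableP; split; first exact/measurable_EFinP/(measurable_wrtW sG GM).
  have /integrableP[_] := iPG.
  by rewrite /PG /distribution ge0_integral_pushforward// ; exact: measurableT_comp.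
exists f; split => // A GA.
transitivity (nuC A) => //.
have mA : measurable (A : set TG) by rewrite G_measurableE.
rewrite (Radon_Nikodym_integral dom mA).
transitivity (\int[PG]_(w in (A : set TG)) (f w)%:E)%E; last first.
  by apply: eq_integral => w _; rewrite fE.
have iA : P.-integrable (idG @^-1` A) ((EFin \o (f : TG -> R)) \o idG).
  exact: (integrableT GA if_).
by rewrite /PG /distribution (integral_pushforward mid mfE iA mA).
Qed.

End conditional_expectation.

(** * Taking out known factors, and Jensen's inequality *)

Section jensen.
Context {R : realType} {d : measure_display} {T : measurableType d}.
Variables (P : probability T R) (G : set (set T)).
Hypotheses (sG : sigma_algebra setT G) (GM : G `<=` measurable).

Lemma is_condexp_ae_eq (X Z W : T -> R) : is_condexp P G X Z ->
  measurable_wrt G W -> P.-integrable setT (EFin \o W) ->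
  {ae P, forall w, Z w = W w} -> is_condexp P G X W.
Proof.
move=> [mZ iZ XZ] mW iW ZW; split => // A GA; rewrite -XZ//.
apply: ae_eq_integral; first exact: GM.
- exact/measurable_funTS/(measurable_int _ iW).
- exact/measurable_funTS/(measurable_int _ iZ).
- by apply: filterS ZW => w ->.
Qed.

(** On each slice [{k e <= B < (k + 1) e}], which belongs to [G], the factor [B] is
    the constant [k e] up to an error of at most [e]; hence
    [|E[B V | G]| <= e E[|V| | G]] on every slice, for every [e > 0]. *)
Lemma is_condexp_pullout_null (V B : T -> R) : Linfm P V -> Linfm P B ->
  measurable_wrt G B -> is_condexp P G V (cst 0) ->
  is_condexp P G (fun w => B w * V w) (cst 0).
Proof.
move=> LV LB mB V0.
have LBV := LinfmM LB LV.
have iBV := Linfm_integrable LBV.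
have i0 : P.-integrable setT (EFin \o (cst 0 : T -> R)).
  exact: finite_measure_integrable_cst.
have m0 : measurable_wrt G (cst 0 : T -> R) by exact: measurable_wrt_cst.
have LnV : Linfm P (fun w => `|V w|).
  apply: (Linfm_le _ (Linfm_powR ler01 LV)).
    exact/measurableT_comp/Linfm_measurable/LV.
  by apply: nearW => w; rewrite powRr1// normr_id.
have [W BVW] := is_condexp_ex sG GM iBV.
have [U VU] := is_condexp_ex sG GM (Linfm_integrable LnV).
have slice (e : R) (k : int) : 0 < e ->
    {ae P, forall w, k%:~R * e <= B w < (k + 1)%:~R * e -> `|W w| <= e * U w}.
  move=> e0; pose A := [set w | k%:~R * e <= B w] `&` [set w | B w < (k + 1)%:~R * e].
  have GA : G A.
    apply: sigma_algebraI => //.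
      exact: (measurable_wrt_le sG (measurable_wrt_cst (k%:~R * e)) mB).
    exact: (measurable_wrt_lt sG mB (measurable_wrt_cst ((k + 1)%:~R * e))).
  have iV := Linfm_integrable LV.
  have LkV := LinfmZ (k%:~R * e) LV.
  have LeV := LinfmZ e LnV.
  have kV := is_condexpZ GM (k%:~R * e) iV V0.
  have eU := is_condexpZ GM e (Linfm_integrable LnV) VU.
  have BA w : A w -> `|B w * V w - k%:~R * e * V w| <= e * `|V w|.
    move=> [/= kB Bk]; rewrite -mulrBl normrM ler_wpM2r// ler_norml.
    by move: Bk; rewrite intrD mulrDl mul1r => Bk; apply/andP; split; lra.
  have h1 := is_condexp_le_on sG GM GA
    (Linfm_integrable (LinfmB LBV LkV)) (Linfm_integrable LeV)
    (is_condexpB GM iBV (Linfm_integrable LkV) BVW kV) eU.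
  have h2 := is_condexp_le_on sG GM GA
    (Linfm_integrable (LinfmB LkV LBV)) (Linfm_integrable LeV)
    (is_condexpB GM (Linfm_integrable LkV) iBV kV BVW) eU.
  apply: filterS2 (h1 _) (h2 _).
  - move=> w {}h1 {}h2 /andP[kB Bk]; have Aw : A w by [].
    by move: (h1 Aw) (h2 Aw); rewrite mulr0 subr0 sub0r => *; rewrite ler_norml; lra.
  - apply: nearW => w /BA; exact/le_trans/ler_norm.
  - by apply: nearW => w /BA; rewrite distrC; exact/le_trans/ler_norm.
have bound : {ae P, forall w, forall n : nat, `|W w| <= n.+1%:R^-1 * U w}.
  apply: ae_foralln => n; have n0 : 0 < n.+1%:R^-1 :> R by rewrite invr_gt0.
  have := ae_forall_countable (fun k : int => slice _ k n0).
  apply: filterS => w /(_ (Num.floor (B w / n.+1%:R^-1))); apply.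
  by rewrite -ler_pdivlMr// -ltr_pdivrMr// floor_le floorD1_gt.
apply: is_condexp_ae_eq BVW m0 i0 _; apply: filterS bound => w Ww.
apply/eqP; rewrite -normr_eq0 eq_le normr_ge0 andbT leNgt; apply/negP => W0.
pose n := Num.bound `|U w / `|W w| |.
have := Ww n; apply/negP; rewrite -ltNge mulrC ltr_pdivrMr// -ltr_pdivrMl// mulrC.
rewrite (le_lt_trans (ler_norm _))// (lt_le_trans (archi_boundP (normr_ge0 _)))//.
by rewrite ler_nat.
Qed.

Lemma is_condexp_pullout (X Z B : T -> R) : Linfm P X -> Linfm P Z ->
  Linfm P B -> measurable_wrt G B -> is_condexp P G X Z ->
  is_condexp P G (fun w => B w * X w) (fun w => B w * Z w).
Proof.
move=> LX LZ LB mB XZ; have [mZ iZ _] := XZ.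
have ZZ := is_condexp_refl mZ iZ.
have V0 : is_condexp P G (fun w => X w - Z w) (cst 0).
  have := is_condexpB GM (Linfm_integrable LX) iZ XZ ZZ.
  by under [X in is_condexp _ _ _ X]eq_fun do rewrite subrr.
have LV := LinfmB LX LZ.
have BV := is_condexp_pullout_null LV LB mB V0.
have LBZ := LinfmM LB LZ; have iBZ := Linfm_integrable LBZ.
have BZ := is_condexp_refl (measurable_wrtM mB mZ) iBZ.
have := is_condexpD GM (Linfm_integrable (LinfmM LB LV)) iBZ BV BZ.
congr is_condexp; apply/funext => w; last by rewrite add0r.
by ring.
Qed.

Section random_convex_function.
Variables (D : nat) (F : T -> 'rV[R]_D -> R).
Hypotheses (cF : forall w, convexf (F w))
  (mF : forall z, measurable_wrt G (fun w => F w z)).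

Definition minorized eps (ab : 'rV[rat]_D * rat) : set T :=
  [set w | forall x, dot (map_mx ratr ab.1) x + ratr ab.2 <= F w x + eps * sqnorm x].

(** A convex function that is negative somewhere is negative at a rational point,
    so countably many constraints suffice. *)
Lemma minorized_measurable eps ab : 0 <= eps -> G (minorized eps ab).
Proof.
move=> e0.
pose r (y : 'rV[rat]_D) : 'rV[R]_D := map_mx ratr y.
have -> : minorized eps ab = \bigcap_(y : 'rV[rat]_D)
    [set w | dot (r ab.1) (r y) + ratr ab.2 <= F w (r y) + eps * sqnorm (r y)].
  apply/seteqP; split => [w Fw y _|w Fw x]; first exact: Fw.
  rewrite leNgt; apply/negP => Fx.
  have cH := convexfD (convexfD (cF w) (convexf_sqnorm e0))
                      (convexf_affine (r ab.1) (ratr ab.2)).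
  have [|y _] := convexf_lt_rat (x := x) (c := 0) cH; first by rewrite subr_lt0.
  by rewrite subr_lt0 ltNge; apply/negP; rewrite negbK; exact: Fw.
apply: sigma_algebra_bigcap_countable => // y; apply: measurable_wrt_le => //.
  exact: measurable_wrt_cst.
by apply: measurable_wrtD => //; exact: measurable_wrt_cst.
Qed.

Lemma measurable_wrt_dot a (z : T -> 'rV[R]_D) : measurable_wrt_rV G z ->
  measurable_wrt G (fun w => dot a (z w)).
Proof.
move=> mz; apply: measurable_wrt_sum => i; apply: measurable_wrtM => //.
exact: measurable_wrt_cst.
Qed.

(** [F w (z w) + |z w|^2] is the supremum of countably many affine functions of
    [z w], each taken on the event that it is a minorant. *)
Lemma measurable_wrt_eval (z : T -> 'rV[R]_D) : measurable_wrt_rV G z ->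
  measurable_wrt G (fun w => F w (z w)).
Proof.
move=> mz.
have msq : measurable_wrt G (fun w => 1 * sqnorm (z w)).
  apply: measurable_wrtM; first exact: measurable_wrt_cst.
  by apply: measurable_wrt_sum => i; exact: measurable_wrtM.
have mFsq : measurable_wrt G (fun w => F w (z w) + 1 * sqnorm (z w)).
  apply: measurable_wrt_gtP => // c.
  have -> : [set w | c < F w (z w) + 1 * sqnorm (z w)] = \bigcup_ab
      (minorized 1 ab `&` [set w | c < dot (map_mx ratr ab.1) (z w) + ratr ab.2]).
    apply/seteqP; split => [w /= cFz|w [ab _ [/= Fab cab]]]; last first.
      exact: lt_le_trans cab (Fab _).
    have eta0 : 0 < F w (z w) + 1 * sqnorm (z w) - c by rewrite subr_gt0.
    have [ab [Fab abz]] := rational_affine_minorant (z w) (cF w) ltr01 eta0.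
    by exists ab => //; split => //=; move: abz; rewrite subKr.
  apply: sigma_algebra_bigcup_countable => // ab; apply: sigma_algebraI => //.
    exact: minorized_measurable.
  apply: measurable_wrt_lt => //; first exact: measurable_wrt_cst.
  apply: measurable_wrtD; last exact: measurable_wrt_cst.
  exact: measurable_wrt_dot.
have := measurable_wrtB mFsq msq.
by under eq_fun do rewrite addrK.
Qed.

(** On the event that a rational affine function is below [F + eps |.|^2], which
    belongs to [G], its value at [z] is at most [W + eps E[|X|^2 | G]]. Taking the
    supremum over these functions and then [eps = 1 / (n + 1)] gives the claim. *)
Lemma conditional_jensen (X z : T -> 'rV[R]_D) (W : T -> R) :
  (forall i, Linfm P (fun w => X w ord0 i)) ->
  (forall i, is_condexp P G (fun w => X w ord0 i) (fun w => z w ord0 i)) ->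
  P.-integrable setT (EFin \o (fun w => F w (X w))) ->
  is_condexp P G (fun w => F w (X w)) W ->
  {ae P, forall w, F w (z w) <= W w}.
Proof.
move=> LX Xz iFX FW.
have Lsq : Linfm P (fun w => sqnorm (X w)).
  by apply: Linfm_sum => i; exact: Linfm_sqr.
have iX i := Linfm_integrable (LX i).
have [S XS] := is_condexp_ex sG GM (Linfm_integrable Lsq).
have affine eps ab : 0 <= eps -> {ae P, forall w, minorized eps ab w ->
    dot (map_mx ratr ab.1) (z w) + ratr ab.2 <= W w + eps * S w}.
  move=> e0; have Lb : Linfm P (cst (ratr ab.2 : R)) by exact: Linfm_cst.
  have Ld : Linfm P (fun w => dot (map_mx ratr ab.1) (X w)).
    by apply: Linfm_sum => i; exact: LinfmZ.
  have Le := LinfmZ eps Lsq.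
  have iFe : P.-integrable setT (EFin \o (fun w => F w (X w) + eps * sqnorm (X w))).
    have := integrableD measurableT iFX (Linfm_integrable Le).
    exact: eq_integrable.
  have dz : is_condexp P G (fun w => dot (map_mx ratr ab.1) (X w))
                           (fun w => dot (map_mx ratr ab.1) (z w)).
    pose a : 'rV[R]_D := map_mx ratr ab.1.
    apply: (@is_condexp_sum _ _ _ P G GM _ _
      (fun i w => a ord0 i * X w ord0 i) (fun i w => a ord0 i * z w ord0 i)) => i.
      exact/Linfm_integrable/LinfmZ.
    exact: is_condexpZ.
  have bb : is_condexp P G (cst (ratr ab.2)) (cst (ratr ab.2)).
    by apply: is_condexp_refl; [exact: measurable_wrt_cst|exact: Linfm_integrable].
  have h := (is_condexp_le_on sG GM (minorized_measurable ab e0)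
    (Linfm_integrable (LinfmD Ld Lb)) iFe
    (is_condexpD GM (Linfm_integrable Ld) (Linfm_integrable Lb) dz bb)
    (is_condexpD GM iFX (Linfm_integrable Le) FW
      (is_condexpZ GM eps (Linfm_integrable Lsq) XS))).
  by apply: filterS (h _) => [w|]; [exact|apply: nearW => w; exact].
have : {ae P, forall w, forall n : nat, forall ab, minorized n.+1%:R^-1 ab w ->
    dot (map_mx ratr ab.1) (z w) + ratr ab.2 <= W w + n.+1%:R^-1 * S w}.
  apply: ae_foralln => n; apply: ae_forall_countable => ab.
  by apply: affine; rewrite invr_ge0.
apply: filterS => w Fw.
have le_n n : F w (z w) <= W w + n.+1%:R^-1 * S w.
  rewrite leNgt; apply/negP => lt_n.
  have n0 : 0 < n.+1%:R^-1 :> R by rewrite invr_gt0.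
  pose eta := F w (z w) - (W w + n.+1%:R^-1 * S w).
  have eta0 : 0 < eta by rewrite subr_gt0.
  have [ab [/Fw + abz]] := rational_affine_minorant (z w) (cF w) n0 eta0.
  move=> abW; have := mulr_ge0 (ltW n0) (sqnorm_ge0 (z w)).
  have := lt_le_trans abz abW; rewrite /eta opprB addrC -addrA.
  set u := _ * sqnorm _; set v := _ * S w; lra.
rewrite leNgt; apply/negP => WF.
pose del := F w (z w) - W w; have d0 : 0 < del by rewrite subr_gt0.
pose n := Num.bound `|S w / del|.
have : n.+1%:R^-1 * S w < del.
  rewrite mulrC ltr_pdivrMr// -ltr_pdivrMl// mulrC.
  rewrite (le_lt_trans (ler_norm _))// (lt_le_trans (archi_boundP (normr_ge0 _)))//.
  by rewrite ler_nat.
by rewrite ltNge -/del lerBlDl le_n.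
Qed.

End random_convex_function.

(** Jensen's inequality for the deterministic function [|x|^p] in dimension one. *)
Lemma is_condexp_Linfm (X Z : T -> R) : Linfm P X -> is_condexp P G X Z ->
  Linfm P Z.
Proof.
move=> LX XZ; have [mZ iZ _] := XZ.
have mZT := measurable_wrtW sG GM mZ.
have /LinfmP[_ iX] := LX.
apply/LinfmP; split => // p p1.
pose F (_ : T) (x : 'rV[R]_1) := `|x ord0 ord0| `^ p.
have cF w : convexf (F w).
  move=> t x y /andP[t0 t1]; rewrite /F !mxE.
  have p0 : 0 <= p by exact: le_trans p1.
  apply: (@le_trans _ _ ((t * `|x ord0 ord0| + (1 - t) * `|y ord0 ord0|) `^ p)).
    apply: ge0_ler_powR; rewrite ?nnegrE//.
      by rewrite addr_ge0// mulr_ge0// subr_ge0.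
    rewrite (le_trans (ler_normD _ _))// !normrM (ger0_norm t0).
    by rewrite (@ger0_norm _ (1 - t)) ?subr_ge0.
  have := convex_powR p1 (Itv01 t0 t1) (x := `|x ord0 ord0|) (y := `|y ord0 ord0|).
  by apply; rewrite inE/= in_itv/= normr_ge0.
have [W FW] := is_condexp_ex sG GM (iX p p1).
have [_ iW _] := FW.
have rowE (Y : T -> R) i : (fun w => (\row_(_ < 1) Y w : 'rV[R]_1) ord0 i) = Y.
  by apply/funext => w; rewrite mxE.
have FE (Y : T -> R) : (fun w => F w (\row_(_ < 1) Y w)) = fun w => `|Y w| `^ p.
  by apply/funext => w; rewrite /F mxE.
have ZW : {ae P, forall w, `|Z w| `^ p <= W w}.
  have mF z : measurable_wrt G (fun w => F w z) by exact: measurable_wrt_cst.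
  have := @conditional_jensen 1 F cF mF (fun w => \row__ X w) (fun w => \row__ Z w) W.
  rewrite FE => jensen.
  have {jensen} : {ae P, forall w, F w (\row_(_ < 1) Z w) <= W w}.
    apply: jensen FW; last exact: iX.
    - by move=> i; rewrite rowE.
    - by move=> i; rewrite !rowE.
  by apply: filterS => w; rewrite /F mxE.
apply/integrableP; split; first exact/measurable_EFinP/measurable_powR_norm.
have /integrableP[_] := iW; apply: le_lt_trans.
apply: ae_ge0_le_integral => //.
- exact/measurableT_comp/measurable_EFinP/measurable_powR_norm.
- exact/measurableT_comp/(measurable_int _ iW).
- apply: filterS ZW => w ZW _ /=; rewrite lee_fin (ger0_norm (powR_ge0 _ _)).
  exact: le_trans ZW (ler_norm _).
Qed.

End jensen.

(** * Dynamic programming *)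

Section condexp_version.
Context {R : realType} {d : measure_display} {T : measurableType d}.
Variables (P : probability T R) (G : set (set T)).
Hypotheses (sG : sigma_algebra setT G) (GM : G `<=` measurable).

Lemma condexpP (X : T -> R) : P.-integrable setT (EFin \o X) ->
  is_condexp P G X (condexp P G X).
Proof.
by move=> /(is_condexp_ex sG GM)[Z XZ]; exact: (xgetPex (fun=> 0) (ex_intro _ Z XZ)).
Qed.

End condexp_version.

Lemma downward_ind (J : nat) (Q : nat -> Prop) : Q J ->
  (forall i, (i < J)%N -> Q i.+1 -> Q i) -> forall i, (i <= J)%N -> Q i.
Proof.
move=> QJ QS i iJ; rewrite -(subKn iJ); elim: (J - i)%N (leq_subr i J) => [|n IH] nJ.
  by rewrite subn0.
apply: QS; first by rewrite ltn_subrL (leq_trans _ nJ).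
by rewrite subnSK//; exact/IH/ltnW.
Qed.

Section dynamic_programming.
Context {R : realType} {d : measure_display} {T : measurableType d}.
Variables (P : probability T R) (J D : nat) (FF : nat -> set (set T)).
Variables (F : nat -> T -> 'rV[R]_D -> R) (beta : nat -> T -> 'rV[R]_D).
Variable xi : T -> R.
Hypothesis standing : standing_assumptions P J FF F beta xi.

Let sFF j : (j <= J)%N -> sigma_algebra setT (FF j).
Proof. by case: standing => -[_ _ + _ _] _ _ _ _; exact. Qed.

Let FFM j : (j <= J)%N -> FF j `<=` measurable.
Proof. by case: standing => -[_ _ _ + _] _ _ _ _; exact. Qed.

Let FFS i : (i < J)%N -> FF i `<=` FF i.+1.
Proof. by case: standing => -[_ _ _ _ h] _ _ _ _ iJ; exact: h. Qed.

Let convF j w : (j < J)%N -> convexf (F j w).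
Proof. by case: standing => _ cF _ _ _ /cF[_ _ h]; exact/convex_functionT/h. Qed.

Let measF j z : (j < J)%N -> measurable_wrt (FF j) (fun w => F j w z).
Proof. by case: standing => _ cF _ _ _ /cF[_ h _]; exact: h. Qed.

Let mbeta j k : (j <= J)%N -> measurable_wrt (FF j) (fun w => beta j w ord0 k).
Proof. by case: standing => _ _ _ [+ _] _ jJ => /(_ j jJ)[+ _]; exact. Qed.

Let Lbeta j k : (j <= J)%N -> Linfm P (fun w => beta j w ord0 k).
Proof.
move=> jJ; apply: Linfm_rV_coord.
  by case: standing => _ _ _ [/(_ j jJ)[]].
exact: measurable_wrtW (sFF jJ) (FFM jJ) _ (mbeta k jJ).
Qed.

Lemma generator_Linfm j (X : T -> 'rV[R]_D) : (j < J)%N ->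
  (forall k, Linfm P (fun w => X w ord0 k)) -> Linfm P (fun w => F j w (X w)).
Proof.
move=> jJ LX; case: standing => _ _ [q [alpha [q0 alpha0 Lalpha growth]]] _ _.
have sM : sigma_algebra setT (@measurable d T) by exact: sigma_algebra_measurable.
have wrtM (Y : T -> R) : measurable_fun setT Y -> measurable_wrt measurable Y.
  by move=> mY _ B mB; rewrite G_measurableE//; exact: mY.
have mF : measurable_fun setT (fun w => F j w (X w)).
  apply: (measurable_wrtW sM) => //.
  apply: measurable_wrt_eval => // [w|z|k]; first exact: convF.
    apply: wrtM; apply: (measurable_wrtW (sFF (ltnW jJ)) (FFM (ltnW jJ))).
    exact: measF.
  exact: wrtM (Linfm_measurable (LX k)).
(* Polynomial growth in S, a random variable with all moments. *)
pose S w : R := D%:R + l1norm (X w).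
have S0 w : 0 <= S w by rewrite addr_ge0// sumr_ge0.
have LS : Linfm P S.
  apply: LinfmD; first exact: Linfm_cst.
  apply: Linfm_sum => k.
  have := Linfm_powR ler01 (LX k).
  by under eq_fun do rewrite powRr1//.
have Lb : Linfm P (fun w => alpha j w * (1 + S w `^ q)).
  have [_ La] := Lalpha j (ltnW jJ).
  apply: LinfmM => //; apply: LinfmD; first exact: Linfm_cst.
  have := Linfm_powR q0 LS.
  by under eq_fun do rewrite ger0_norm//.
apply: (Linfm_le mF Lb).
have := ae_forall_countable (fun y : 'rV[rat]_D => growth j (map_mx ratr y) jJ).
apply: filterS => w Fw.
by apply: convexf_growth => //; [exact: convF|exact/alpha0/ltnW].
Qed.

(** Comparing the constants [0] and [-n] bounds [F_j] along the whole ray spanned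
    by [- beta_{j+1}], outside a single null set. *)
Lemma beta_recession j : (j < J)%N -> {ae P, forall w, forall z t, 0 <= t ->
  F j w (z - t *: beta j.+1 w) <= F j w z}.
Proof.
move=> jJ; case: standing => _ _ _ _ mono.
have : {ae P, forall w, forall n : nat, F j w (n%:R *: - beta j.+1 w) <= F j w 0}.
  apply: ae_foralln => n.
  have ae0 : {ae P, forall w, cst (- n%:R) w <= cst 0 w :> R}.
    by apply: nearW => w /=; rewrite oppr_le0.
  have := mono _ _ (Linfm_cst P 0) (Linfm_cst P (- n%:R)) ae0 j jJ.
  by apply: filterS => w /=; rewrite scale0r scaleNr scalerN.
apply: filterS => w Fw z t t0; rewrite -scalerN.
exact: recession_direction (convF w jJ) Fw z t t0.
Qed.

(** [u] is the conditional expectation of [X = v - (V - U) beta_{j+1}], and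
    [F_j (X) <= F_j (v)] pathwise by the recession property, so Jensen's
    inequality gives [F_j (u) <= E_j[F_j (X)] <= E_j[F_j (v)] = F_j (v)]. *)
Lemma generator_condexp_mono j (U V : T -> R) (u v : T -> 'rV[R]_D) : (j < J)%N ->
  Linfm P U -> Linfm P V -> {ae P, forall w, U w <= V w} ->
  (forall k, is_condexp P (FF j) (fun w => U w * beta j.+1 w ord0 k)
                                 (fun w => u w ord0 k)) ->
  (forall k, is_condexp P (FF j) (fun w => V w * beta j.+1 w ord0 k)
                                 (fun w => v w ord0 k)) ->
  {ae P, forall w, F j w (u w) <= F j w (v w)}.
Proof.
move=> jJ LU LV UV Uu Vv; have jJ' := ltnW jJ.
have sG := sFF jJ'; have GM := FFM jJ'.
have LUb k := LinfmM LU (Lbeta k jJ); have LVb k := LinfmM LV (Lbeta k jJ).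
have Lv k := is_condexp_Linfm sG GM (LVb k) (Vv k).
pose X w := v w - (V w - U w) *: beta j.+1 w.
have XE k : (fun w => X w ord0 k) = fun w => v w ord0 k -
    (V w * beta j.+1 w ord0 k - U w * beta j.+1 w ord0 k).
  by apply/funext => w; rewrite !mxE mulrBl.
have LX k : Linfm P (fun w => X w ord0 k).
  by rewrite XE; apply: LinfmB => //; exact: LinfmB.
have LFX := generator_Linfm jJ LX; have LFv := generator_Linfm jJ Lv.
have Xu k : is_condexp P (FF j) (fun w => X w ord0 k) (fun w => u w ord0 k).
  have vv : is_condexp P (FF j) (fun w => v w ord0 k) (fun w => v w ord0 k).
    by case: (Vv k) => mv iv _; exact: is_condexp_refl.
  have := is_condexpB GM (Linfm_integrable (LVb k)) (Linfm_integrable (LUb k))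
    (Vv k) (Uu k).
  move=> /(is_condexpB GM (Linfm_integrable (Lv k))
    (Linfm_integrable (LinfmB (LVb k) (LUb k))) vv).
  by rewrite -XE; under [X in is_condexp _ _ _ X -> _]eq_fun do rewrite subKr.
have mv : measurable_wrt (FF j) (fun w => F j w (v w)).
  apply: measurable_wrt_eval => // [w|z|k]; [exact: convF|exact: measF|].
  by case: (Vv k).
(* W is a version of the conditional expectation of F_j (X). *)
have [W FW] := is_condexp_ex sG GM (Linfm_integrable LFX).
have leW := conditional_jensen sG GM (fun w => convF w jJ) (fun z => measF z jJ)
  LX Xu (Linfm_integrable LFX) FW.
have Wle : {ae P, forall w, W w <= F j w (v w)}.
  apply: (is_condexp_le sG GM (Linfm_integrable LFX) (Linfm_integrable LFv) FW).
    exact: is_condexp_refl mv (Linfm_integrable LFv).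
  apply: filterS2 UV (beta_recession jJ) => w UVw; apply.
  by rewrite subr_ge0.
by apply: filterS2 leW Wle => w; exact: le_trans.
Qed.

Lemma condexp_weightedP j (Y : T -> R) k : (j < J)%N -> Linfm P Y ->
  is_condexp P (FF j) (fun w => Y w * beta j.+1 w ord0 k)
    (fun w => condexp_rV P (FF j) (fun w' => Y w' *: beta j.+1 w') w ord0 k).
Proof.
move=> jJ LY; have jJ' := ltnW jJ.
have := condexpP (sFF jJ') (FFM jJ') (Linfm_integrable (LinfmM LY (Lbeta k jJ))).
congr is_condexp; apply/funext => w; rewrite mxE; congr (condexp _ _ _ w).
by apply/funext => w'; rewrite mxE.
Qed.

Section supersolutions.
Variables Y Ybar : nat -> T -> R.
Hypotheses (solY : dp_solution P J FF F beta xi Y)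
  (superY : supersolution P J FF F beta Y Ybar).

Let Mbar := doob_martingale P FF (weighted beta Ybar).
Let theta := theta_up J F beta xi Mbar.
Let C j := condexp_rV P (FF j) (weighted beta Ybar j.+1).

Let LYbar j : (j <= J)%N -> Linfm P (Ybar j).
Proof. by case: superY => + _ _ => /[apply] -[]. Qed.

Let LY j : (j <= J)%N -> Linfm P (Y j).
Proof. by case: solY => + _ _ => /[apply] -[]. Qed.

Let thetaJ : theta J = xi.
Proof. by apply/funext => w; exact: theta_upJ. Qed.

(** The increment of the Doob martingale is
    [Ybar_{j+1} beta_{j+1} - E_j[Ybar_{j+1} beta_{j+1}]], which centres the
    recursion at the argument of the dynamic program. *)
Lemma theta_up_doobS j w : (j < J)%N -> theta j w =
  F j w (C j w - (Ybar j.+1 w - theta j.+1 w) *: beta j.+1 w).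
Proof.
move=> jJ; rewrite /theta theta_upS//; congr (F j w _).
rewrite /Mbar /doob_martingale big_nat_recr//= (addrC (\sum_(0 <= _ < j) _)) addrK.
by rewrite -/(C j w) /weighted scalerBl !opprB addrCA addrA.
Qed.

Let CP j k : (j < J)%N ->
  is_condexp P (FF j) (fun w => Ybar j.+1 w * beta j.+1 w ord0 k)
                      (fun w => C j w ord0 k).
Proof. by move=> jJ; exact/condexp_weightedP/LYbar. Qed.

Let LC j k : (j < J)%N -> Linfm P (fun w => C j w ord0 k).
Proof.
move=> jJ; have jJ' := ltnW jJ.
exact: (is_condexp_Linfm (sFF jJ') (FFM jJ') (LinfmM (LYbar jJ) (Lbeta k jJ))
  (CP k jJ)).
Qed.

Let X j w := C j w - (Ybar j.+1 w - theta j.+1 w) *: beta j.+1 w.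

Let XE j k : (fun w => X j w ord0 k) = fun w => C j w ord0 k -
  (Ybar j.+1 w * beta j.+1 w ord0 k - theta j.+1 w * beta j.+1 w ord0 k).
Proof. by apply/funext => w; rewrite !mxE mulrBl. Qed.

Let LX j k : (j < J)%N -> Linfm P (theta j.+1) -> Linfm P (fun w => X j w ord0 k).
Proof.
move=> jJ Lt; rewrite XE; apply: LinfmB; first exact: LC.
by apply: LinfmB; apply: LinfmM => //; [exact: LYbar|exact: Lbeta..].
Qed.

Let thetaE j : (j < J)%N -> theta j = fun w => F j w (X j w).
Proof. by move=> jJ; apply/funext => w; exact: theta_up_doobS. Qed.

Lemma theta_up_Linfm j : (j <= J)%N -> Linfm P (theta j).
Proof.
move: j; apply: downward_ind => [|j jJ Lt].
  by rewrite thetaJ; case: standing => _ _ _ [_ []].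
by rewrite thetaE//; apply: generator_Linfm => // k; exact: LX.
Qed.

Lemma theta_up_le_dp_rhs j : (j < J)%N ->
  {ae P, forall w, theta j.+1 w <= Ybar j.+1 w} ->
  {ae P, forall w, theta j w <= dp_rhs P FF F beta Ybar j w}.
Proof.
move=> jJ; apply: filterS2 (beta_recession jJ) => w rec tY.
by rewrite theta_up_doobS//; apply: rec; rewrite subr_ge0.
Qed.

Lemma theta_up_le_super j : (j <= J)%N -> {ae P, forall w, theta j w <= Ybar j w}.
Proof.
have [_ YJ _] := solY; have [_ YbarJ Ybarj] := superY.
move: j; apply: downward_ind => [|j jJ IH].
  by apply: filterS2 YJ YbarJ => w; rewrite thetaJ => ->.
by apply: filterS2 (theta_up_le_dp_rhs jJ IH) (Ybarj j jJ) => w; exact: le_trans.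
Qed.

Let condexp_theta j : (j <= J)%N -> is_condexp P (FF j) (theta j) (condexp P (FF j) (theta j)).
Proof.
by move=> jJ; exact: (condexpP (sFF jJ) (FFM jJ) (Linfm_integrable (theta_up_Linfm jJ))).
Qed.

(** Backward induction: Jensen's inequality moves [E_j] inside [F_j], the
    martingale increment disappears under [E_j], and conditioning [theta_{j+1}]
    first on time [j + 1] brings in the induction hypothesis. *)
Lemma solution_le_condexp_theta_up j : (j <= J)%N ->
  {ae P, forall w, Y j w <= condexp P (FF j) (theta j) w}.
Proof.
have [_ YJ Yj] := solY.
move: j; apply: downward_ind => [|j jJ IH].
  have [_ _ _ [_ [mxi Lxi]] _] := standing.
  have ixi := Linfm_integrable Lxi.
  have := condexp_theta (leqnn J); rewrite thetaJ => xiE.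
  have aexi : {ae P, forall w, xi w = xi w} by exact: nearW.
  have := is_condexp_eq (sFF (leqnn J)) (FFM (leqnn J)) ixi ixi
    (is_condexp_refl mxi ixi) xiE aexi.
  by apply: filterS2 YJ => w -> ->.
have jJ' := ltnW jJ; have sG := sFF jJ'; have GM := FFM jJ'.
have sG' := sFF jJ; have GM' := FFM jJ.
have Lt := theta_up_Linfm jJ; have Lt' := theta_up_Linfm jJ'.
pose E := condexp P (FF j.+1) (theta j.+1).
have LE : Linfm P E := is_condexp_Linfm sG' GM' Lt (condexp_theta jJ).
pose z := condexp_rV P (FF j) (fun w => E w *: beta j.+1 w).
have Ez k := condexp_weightedP k jJ LE.
have tz k : is_condexp P (FF j) (fun w => theta j.+1 w * beta j.+1 w ord0 k)
                                (fun w => z w ord0 k).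
  apply: is_condexp_tower (FFS jJ) _ (Ez k).
  have := is_condexp_pullout sG' GM' Lt LE (Lbeta k jJ) (mbeta k jJ) (condexp_theta jJ).
  by congr is_condexp; apply/funext => w; rewrite mulrC.
have Ltb k := LinfmM Lt (Lbeta k jJ).
have LYb k := LinfmM (LYbar jJ) (Lbeta k jJ).
have Xz k : is_condexp P (FF j) (fun w => X j w ord0 k) (fun w => z w ord0 k).
  have CC : is_condexp P (FF j) (fun w => C j w ord0 k) (fun w => C j w ord0 k).
    by case: (CP k jJ) => mC iC _; exact: is_condexp_refl.
  have := is_condexpB GM (Linfm_integrable (LYb k)) (Linfm_integrable (Ltb k))
    (CP k jJ) (tz k).
  move=> /(is_condexpB GM (Linfm_integrable (LC k jJ))
    (Linfm_integrable (LinfmB (LYb k) (Ltb k))) CC).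
  by rewrite -XE; under [X in is_condexp _ _ _ X -> _]eq_fun do rewrite subKr.
have Fz : {ae P, forall w, F j w (z w) <= condexp P (FF j) (theta j) w}.
  have tE := condexp_theta jJ'; rewrite [X in is_condexp _ _ X _]thetaE// in tE.
  apply: (conditional_jensen sG GM (fun w => convF w jJ) (fun z => measF z jJ)
    (fun k => LX k jJ Lt) Xz _ tE).
  by rewrite -thetaE//; exact: Linfm_integrable.
have uz := generator_condexp_mono jJ (LY jJ) LE IH
  (fun k => condexp_weightedP k jJ (LY jJ)) Ez.
apply: filterS3 (Yj j jJ) uz Fz => w -> h1 h2; exact: le_trans h1 h2.
Qed.

Lemma condexp_theta_up_le_dp_rhs j : (j < J)%N ->
  {ae P, forall w, condexp P (FF j) (theta j) w <= dp_rhs P FF F beta Ybar j w}.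
Proof.
move=> jJ; have jJ' := ltnW jJ.
have LFC : Linfm P (dp_rhs P FF F beta Ybar j).
  by apply: generator_Linfm => // k; exact: LC.
apply: (is_condexp_le (sFF jJ') (FFM jJ')
  (Linfm_integrable (theta_up_Linfm jJ')) (Linfm_integrable LFC)
  (condexp_theta jJ')).
- apply: is_condexp_refl; last exact: Linfm_integrable.
  apply: (measurable_wrt_eval (sFF jJ')) => [w|z|k]; [exact: convF|exact: measF|].
  by case: (CP k jJ).
- exact/theta_up_le_dp_rhs/theta_up_le_super.
Qed.

(** The conditional expectations are chosen versions, so equality is obtained from
    monotonicity in both directions. *)
Lemma dp_rhs_ae_eq j : (j < J)%N -> {ae P, forall w, Ybar j.+1 w = Y j.+1 w} ->
  {ae P, forall w, dp_rhs P FF F beta Ybar j w = Y j w}.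
Proof.
move=> jJ YY; have [_ _ Yj] := solY.
have le1 : {ae P, forall w, Ybar j.+1 w <= Y j.+1 w} by apply: filterS YY => w ->.
have le2 : {ae P, forall w, Y j.+1 w <= Ybar j.+1 w} by apply: filterS YY => w ->.
have YP k := condexp_weightedP k jJ (LY jJ).
have h1 := generator_condexp_mono jJ (LYbar jJ) (LY jJ) le1 (fun k => CP k jJ) YP.
have h2 := generator_condexp_mono jJ (LY jJ) (LYbar jJ) le2 YP (fun k => CP k jJ).
apply: filterS3 (Yj j jJ) h1 h2 => w -> {}h1 {}h2.
by apply/le_anti; apply/andP; split.
Qed.

Lemma theta_up_eq_solution j : (j < J)%N ->
  (forall i, (j.+1 <= i <= J)%N -> {ae P, forall w, Ybar i w = Y i w}) ->
  {ae P, forall w, theta j w = Y j w}.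
Proof.
move=> jJ YY.
suff : forall i, (i <= J)%N -> (j <= i)%N -> {ae P, forall w, theta i w = Y i w}.
  by apply => //; exact: ltnW.
apply: downward_ind => [_|i iJ IH ji].
  by have [_ + _] := solY; apply: filterS => w ->; rewrite thetaJ.
have YYi : {ae P, forall w, Ybar i.+1 w = Y i.+1 w} by apply: YY; rewrite ltnS ji.
apply: filterS3 (IH (leqW ji)) YYi (dp_rhs_ae_eq iJ YYi) => w tY YbarY <-.
by rewrite theta_up_doobS// tY YbarY subrr scale0r subr0.
Qed.

End supersolutions.
End dynamic_programming.

Theorem theorem4p1 (R : realType) (d : measure_display) (T : measurableType d)
    (P : probability T R) (J D : nat) (FF : nat -> set (set T))
    (F : nat -> T -> 'rV[R]_D -> R) (beta : nat -> T -> 'rV[R]_D) (xi : T -> R)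
    (Y Ybar : nat -> T -> R) (j : nat) :
  standing_assumptions P J FF F beta xi ->
  dp_solution P J FF F beta xi Y ->
  (j < J)%N ->
  supersolution P J FF F beta Y Ybar ->
  let Mbar := doob_martingale P FF (weighted beta Ybar) in
  let theta := theta_up J F beta xi Mbar in
  (forall i, (i < J)%N ->
     {ae P, forall w,
       [/\ Y i w <= condexp P (FF i) (theta i) w,
           condexp P (FF i) (theta i) w <=
             F i w (condexp_rV P (FF i) (weighted beta Ybar i.+1) w)
         & F i w (condexp_rV P (FF i) (weighted beta Ybar i.+1) w) <=
             Ybar i w]}) /\
  ((forall i, (j.+1 <= i <= J)%N -> {ae P, forall w, Ybar i w = Y i w}) ->
   {ae P, forall w, theta j w = Y j w}).
Proof.
move=> standing solY jJ superY Mbar theta; split; last first.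
  exact: theta_up_eq_solution.
move=> i iJ; have [_ _ Ybari] := superY.
apply: filterS3 (solution_le_condexp_theta_up standing solY superY (ltnW iJ))
  (condexp_theta_up_le_dp_rhs standing solY superY iJ) (Ybari i iJ) => w ? ? ?.
by split.
Qed.
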